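(* Let $n$ be a positive integer, $\rho>0$, and let $(T_1,\ldots,T_n)$ be an $n$-tuple of operators $T_i\in B(\mathcal H)$. The $\rho$-operator radius has the following properties: (i) $\omega_\rho(zT_1,\ldots,zT_n)=|z|\,\omega_\rho(T_1,\ldots,T_n)$ for any $z\in\mathbb C$; (ii) $\|[T_1,\ldots,T_n]\|\le\rho\,\omega_\rho(T_1,\ldots,T_n)$; (iii) $\omega_\rho(T_1,\ldots,T_n)=0$ if and only if $T_1=\cdots=T_n=0$; (iv) $(T_1,\ldots,T_n)\in\mathcal C_\rho$ if and only if $\omega_\rho(T_1,\ldots,T_n)\le1$; (v) $\omega_\infty(T_1,\ldots,T_n)=r(T_1,\ldots,T_n)\le\omega_\rho(T_1,\ldots,T_n)$; (vi) if $0<\rho\le\rho'$, then $\mathcal C_\rho\subseteq\mathcal C_{\rho'}$ and $\omega_{\rho'}(T_1,\ldots,T_n)\le\omega_\rho(T_1,\ldots,T_n)$.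
   Context: $\mathcal H$ is a complex Hilbert space. $\mathbb F_n^+$ is the unital free semigroup on $g_1,\ldots,g_n$ with identity $g_0$; for $\alpha=g_{i_1}\cdots g_{i_k}$, $|\alpha|=k$, $T_\alpha=T_{i_1}\cdots T_{i_k}$. $\|[T_1,\ldots,T_n]\|=\|\sum T_iT_i^*\|^{1/2}$. For $\rho>0$, $(T_1,\ldots,T_n)$ belongs to the class $\mathcal C_\rho$ if there exist a Hilbert space $\mathcal K\supseteq\mathcal H$ and isometries $V_1,\ldots,V_n\in B(\mathcal K)$ with orthogonal ranges such that $T_\alpha=\rho P_{\mathcal H}V_\alpha|_{\mathcal H}$ for any $\alpha\in\mathbb F_n^+\setminus\{g_0\}$. The $\rho$-operator radius is $\omega_\rho(T_1,\ldots,T_n):=\inf\{t>0:(\frac1tT_1,\ldots,\frac1tT_n)\in\mathcal C_\rho\}$, and $\omega_\infty(T_1,\ldots,T_n):=\lim_{\rho\to\infty}\omega_\rho(T_1,\ldots,T_n)$. Joint spectral radius: $r(T_1,\ldots,T_n):=\lim_{k\to\infty}\left\|\sum_{|\alpha|=k}T_\alpha T_\alpha^*\right\|^{1/2k}$. *)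

(* Defs.v *)
From HB Require Import structures.
From mathcomp Require Import all_boot all_order all_algebra.
From mathcomp Require Import complex.
From mathcomp Require Import all_classical all_reals all_analysis.
From mathcomp Require Import sesquilinear.

Set Implicit Arguments.
Unset Strict Implicit.
Unset Printing Implicit Defensive.

Import Order.TTheory GRing.Theory Num.Theory.
Import numFieldNormedType.Exports.
Local Open Scope classical_set_scope.
Local Open Scope complex_scope.
Local Open Scope ring_scope.

(* The inner product is linear in its first argument and conjugate-linear in
   its second one. *)
HB.mixin Record NormedModule_isHilbert (R : realType) V
    of CompleteNormedModule R[i] V := {
  ip : {dot V for Num.conj};
  ipxx : forall x : V, ip x x = `|x| ^+ 2
}.

#[short(type="hilbertType")]
HB.structure Definition Hilbert (R : realType) :=
  {V of NormedModule_isHilbert R V & CompleteNormedModule R[i] V}.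

Section RhoDilations.
Context {R : realType}.

(* The norm of a normed space over R[i] takes its values in the nonnegative
   reals of R[i]; rnorm is the same number seen in R. *)
Definition rnorm {V : normedZmodType R[i]} (x : V) : R := complex.Re `|x|.

(* [opnorm] and [adjoint] are meaningful for bounded linear operators, to which
   they are only applied below: the set in [opnorm] is then bounded, and exactly
   one B satisfies the identity in [adjoint] (it exists by the Riesz
   representation theorem). *)
Definition opnorm {H : hilbertType R} (A : H -> H) : R :=
  sup [set rnorm (A x) | x in [set x : H | rnorm x <= 1]].

Definition adjoint {H : hilbertType R} (A : H -> H) : H -> H :=
  get [set B : H -> H | forall x y : H, ip (A x) y = ip x (B y)].

(* With J : H -> K the inclusion of H in K, P : K -> H is the orthogonal
   projection of K onto H: y - P y is orthogonal to H for every y in K. *)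
Definition is_orthoproj {H K : hilbertType R} (J : H -> K) (P : K -> H) : Prop :=
  forall (y : K) (h : H), ip (y - J (P y)) (J h) = 0.

Section Tuples.
Context {n : nat}.

(* Elements of the free semigroup on n generators are words over 'I_n, the
   identity g_0 being the empty word. *)
Definition word_op {H : hilbertType R} (T : 'I_n -> {linear H -> H})
    (alpha : seq 'I_n) (x : H) : H :=
  foldr (fun i y => T i y) x alpha.

Definition row_norm {H : hilbertType R} (T : 'I_n -> {linear H -> H}) : R :=
  Num.sqrt (opnorm (fun x : H => \sum_(i < n) T i (adjoint (T i) x))).

(* An inclusion of Hilbert spaces H <= K is rendered by a linear isometry
   J : H -> K. The tuples in the class consist of bounded operators, since the
   words of length one give T i = rho P (V i) J. *)
Definition class_C {H : hilbertType R} (rho : R) :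
    set ('I_n -> {linear H -> H}) :=
  [set T | exists (K : hilbertType R) (J : {linear H -> K}) (P : K -> H)
             (V : 'I_n -> {linear K -> K}),
     [/\ isometry ip ip J,
         is_orthoproj J P,
         forall i, isometry ip ip (V i),
         forall i j, i != j -> forall x y : K, ip (V i x) (V j y) = 0
       & forall (alpha : seq 'I_n) (x : H), alpha != [::] ->
           word_op T alpha x = rho%:C *: P (word_op V alpha (J x))]].

Definition scale_tuple {H : hilbertType R} (z : R[i])
    (T : 'I_n -> {linear H -> H}) : 'I_n -> {linear H -> H} :=
  fun i => z \*: T i.

Definition omega {H : hilbertType R} (rho : R)
    (T : 'I_n -> {linear H -> H}) : R :=
  inf [set t : R | 0 < t /\ class_C rho (scale_tuple (t^-1)%:C T)].

Definition omega_infty {H : hilbertType R} (T : 'I_n -> {linear H -> H}) : R :=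
  lim (omega rho T @[rho --> +oo]).

Definition spectral_seq {H : hilbertType R} (T : 'I_n -> {linear H -> H})
    (k : nat) : R :=
  opnorm (fun x : H => \sum_(alpha : k.-tuple 'I_n)
            word_op T alpha (adjoint (word_op T alpha) x)) `^ (2 * k%:R)^-1.

Definition joint_spectral_radius {H : hilbertType R}
    (T : 'I_n -> {linear H -> H}) : R :=
  lim (spectral_seq T k @[k --> \oo]).

End Tuples.
End RhoDilations.

(* Main.v *)
From HB Require Import structures.
Require Import Defs.
From mathcomp Require Import all_boot all_order all_algebra.
From mathcomp Require Import complex.
From mathcomp Require Import all_classical all_reals all_analysis.
From mathcomp Require Import sesquilinear ring lra.

(** The class [C_rho] is characterised by positivity of a kernel on pairs
(word, vector): if [T_a = rho P V_a], then [<V_a x, V_b y>] is [<T_c x, y> / rho]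
for [a = b c], [<x, T_c y> / rho] for [b = a c] (without the factor [1 / rho] for
[a = b]) and [0] otherwise, hence depends on [T] only. Conversely, a positive kernel of
this form has a reproducing kernel Hilbert space, on which the adjoints of the
restrictions [f |-> f(i a, x)] are isometries with orthogonal ranges dilating [T].

The properties of [omega_rho] follow from closure properties of positive
kernels: multiplication of [T] by [s] in [[0,1]] is the Schur product with the Toeplitz
kernel [s ^ | |a| - |b| |]; positivity passes to the limit [s -> 1]; the kernel of
[rho' >= rho] is a convex combination of the kernels of [rho] for [T] and for [0].
If [2 sum_(k >= 1) |[T_a]_(|a| = k)| <= rho], the off-diagonal part of the kernel is
dominated by its diagonal, so [T] lies in [C_rho]; with Fekete's lemma this bounds
[omega_rho] by any [t > r(T)] for large [rho]. In the other direction a dilation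
bounds the row of all [T_a], [|a| = k], by [rho omega_rho ^ k], whence
[r(T) <= omega_rho]. *)

Set Implicit Arguments.
Unset Strict Implicit.
Unset Printing Implicit Defensive.

Import Order.TTheory GRing.Theory Num.Theory.
Import numFieldNormedType.Exports.
Local Open Scope classical_set_scope.
Local Open Scope ring_scope.

(** Kernels trade the quantifier over Hilbert spaces in [class_C] for scalar inequalities in [T].
    The price is a reproducing kernel space that must be an instance of [hilbertType], complete in
    particular. Instead of dividing formal sums by null vectors and completing, the space consists
    from the start of the functions [phi] for which [2 Re <phi, l> - |l|^2] is bounded over formal
    sums [l]; the supremum is the squared norm. Completeness then comes from pointwise limits, and
    restriction to words with a given first letter is clearly a contraction. This norm arises
    without an inner product, which is recovered from the parallelogram law. Adjoints enter twice,
    in the isometries and in the operator norms, and rest on Riesz representation. Most computations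
    use the real part of the inner product, which is symmetric and determines the complex one. *)

Section ComplexRe.
Context {R : realType}.
Implicit Types (z w : R[i]) (r : R).
Local Notation Re := (@complex.Re R).
Local Notation Im := (@complex.Im R).

Lemma Re0 : Re 0 = 0. Proof. by []. Qed.

Lemma ReD z w : Re (z + w) = Re z + Re w.
Proof. by case: z w => [a b] [c d]. Qed.

Lemma ReN z : Re (- z) = - Re z.
Proof. by case: z. Qed.

Lemma ReB z w : Re (z - w) = Re z - Re w.
Proof. by rewrite ReD ReN. Qed.

Lemma ReM z w : Re (z * w) = Re z * Re w - Im z * Im w.
Proof. by case: z w => [a b] [c d]. Qed.

Lemma ReZ r z : Re (r%:C%C * z) = r * Re z.
Proof. by case: z => [a b]; rewrite ReM /= mul0r subr0. Qed.

Lemma ReJ z : Re (Num.conj z) = Re z.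
Proof. by case: z. Qed.

Lemma Re_sum (I : Type) (s : seq I) (P : pred I) (F : I -> R[i]) :
  Re (\sum_(i <- s | P i) F i) = \sum_(i <- s | P i) Re (F i).
Proof. by apply: (big_morph Re ReD). Qed.

Lemma complexRK z : z = (Re z)%:C%C + 'i%C * (Im z)%:C%C.
Proof. exact: complexE. Qed.

Lemma scaleii (V : lmodType R[i]) (x : V) : 'i%C *: ('i%C *: x) = - x.
Proof. by rewrite scalerA -expr2 sqr_i scaleN1r. Qed.

End ComplexRe.

Lemma dot_cauchy_schwarz (R : realType) (V : lmodType R[i])
    (f : {dot V for Num.conj}) (x y : V) :
  complex.Re (f x y) ^+ 2 <= complex.Re (f x x) * complex.Re (f y y).
Proof.
have pos z : 0 <= complex.Re (f z z).
  by have := dnorm_ge0 f z; rewrite lecE => /andP[].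
have [->|y0] := eqVneq y 0; first by rewrite !linear0r !Re0 expr0n lexx.
have y_gt0 : 0 < complex.Re (f y y).
  by have := neq0_dnorm_gt0 (s := f) y y0; rewrite ltcE => /andP[].
pose g u v := complex.Re (f u v); rewrite -![complex.Re _]/(g _ _) in y_gt0 *.
have gC u v : g u v = g v u by rewrite /g (hermC f u v) mul1r ReJ.
have gDl u v w : g (u + v) w = g u w + g v w by rewrite /g linearDl ReD.
have gDr u v w : g w (u + v) = g w u + g w v by rewrite gC gDl !(gC w).
have gZl r u v : g (r%:C%C *: u) v = r * g u v by rewrite /g linearZl_LR ReZ.
have gZr r u v : g u (r%:C%C *: v) = r * g u v by rewrite gC gZl gC.
(* This vector is [g y y] times the component of [x] orthogonal to [y] for [g]; its square is
   [g y y * (g x x * g y y - g x y ^+ 2)]. *)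
have := pos ((g y y)%:C%C *: x + (- g x y)%:C%C *: y).
rewrite -[complex.Re _]/(g _ _) !(gDl, gDr, gZl, gZr) (gC y x) => h.
have : 0 <= g y y * (g x x * g y y - g x y ^+ 2) by lra.
by rewrite pmulr_rge0// subr_ge0.
Qed.

(** * The real inner product underlying a complex Hilbert space *)

Section HilbertReal.
Context {R : realType} {H : hilbertType R}.
Implicit Types (x y z : H) (r t : R).

Definition rip x y : R := complex.Re (ip x y).

Lemma ipBl x y z : ip (x - y) z = ip x z - ip y z.
Proof. exact: linearBl. Qed.

Lemma ipDl x y z : ip (x + y) z = ip x z + ip y z.
Proof. exact: linearDl. Qed.

Lemma ipZl (c : R[i]) x y : ip (c *: x) y = c * ip x y.
Proof. exact: linearZl_LR. Qed.

Lemma ipZr (c : R[i]) x y : ip x (c *: y) = Num.conj c * ip x y.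
Proof. exact: linearZr_LR. Qed.

Lemma ip0l x : ip 0 x = 0.
Proof. exact: linear0l. Qed.

Lemma ipC x y : ip x y = Num.conj (ip y x).
Proof. by rewrite (hermC ip x y) mul1r. Qed.

Lemma ripDl x y z : rip (x + y) z = rip x z + rip y z.
Proof. by rewrite /rip linearDl ReD. Qed.

Lemma ripDr x y z : rip x (y + z) = rip x y + rip x z.
Proof. by rewrite /rip linearDr ReD. Qed.

Lemma ripNl x y : rip (- x) y = - rip x y.
Proof. by rewrite /rip linearNl ReN. Qed.

Lemma ripNr x y : rip x (- y) = - rip x y.
Proof. by rewrite /rip linearNr ReN. Qed.

Lemma ripZl r x y : rip (r%:C%C *: x) y = r * rip x y.
Proof. by rewrite /rip linearZl_LR ReZ. Qed.

Lemma ripC x y : rip x y = rip y x.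
Proof. by rewrite /rip (hermC ip x y) mul1r ReJ. Qed.

Lemma ripZr r x y : rip x (r%:C%C *: y) = r * rip x y.
Proof. by rewrite ripC ripZl ripC. Qed.

Lemma rip0l y : rip 0 y = 0.
Proof. by rewrite /rip linear0l. Qed.

Lemma rip0r y : rip y 0 = 0.
Proof. by rewrite ripC rip0l. Qed.

Lemma rip_suml (I : Type) (s : seq I) (P : pred I) (F : I -> H) y :
  rip (\sum_(i <- s | P i) F i) y = \sum_(i <- s | P i) rip (F i) y.
Proof.
by apply: (big_morph (rip^~ y)) => [u v|]; rewrite ?ripDl ?rip0l.
Qed.

Lemma rip_sumr (I : Type) (s : seq I) (P : pred I) (F : I -> H) y :
  rip y (\sum_(i <- s | P i) F i) = \sum_(i <- s | P i) rip y (F i).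
Proof. by rewrite ripC rip_suml; apply: eq_bigr => i _; rewrite ripC. Qed.

Lemma ripi x y : rip ('i%C *: x) ('i%C *: y) = rip x y.
Proof.
rewrite /rip linearZl_LR linearZr_LR /= mulrA.
have -> : 'i%C * Num.conj 'i%C = 1 :> R[i].
  by apply/eqP; rewrite eq_complex /=; apply/andP; split; apply/eqP; ring.
by rewrite mul1r.
Qed.

(** Conjugate-linearity in the second argument gives [Re <x, i y> = Im <x, y>]. *)
Lemma ipE x y : ip x y = (rip x y +i* rip x ('i%C *: y))%C.
Proof.
rewrite /rip linearZr_LR /=; case: (ip x y) => a b /=.
by congr Complex; ring.
Qed.

Lemma normE (V : normedZmodType R[i]) (x : V) : `|x| = (rnorm x)%:C%C.
Proof. by rewrite /rnorm RRe_real// normr_real. Qed.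

Lemma rnorm_ge0 (V : normedZmodType R[i]) (x : V) : 0 <= rnorm x.
Proof. by rewrite -ler0c -normE. Qed.

Lemma rnormD (V : normedZmodType R[i]) (x y : V) :
  rnorm (x + y) <= rnorm x + rnorm y.
Proof. by rewrite -lecR rmorphD /= -!normE ler_normD. Qed.

Lemma rnorm0 (V : normedZmodType R[i]) : rnorm (0 : V) = 0.
Proof. by rewrite /rnorm normr0. Qed.

Lemma rnormN (V : normedZmodType R[i]) (x : V) : rnorm (- x) = rnorm x.
Proof. by rewrite /rnorm normrN. Qed.

Lemma rnorm0_eq0 (V : normedZmodType R[i]) (x : V) : rnorm x = 0 -> x = 0.
Proof. by move=> x0; apply/normr0_eq0; rewrite normE x0. Qed.

Lemma rnormZ (z : R[i]) (V : normedModType R[i]) (x : V) :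
  rnorm (z *: x) = rnorm z * rnorm x.
Proof. by apply: complexI; rewrite rmorphM /= -!normE normrZ. Qed.

Lemma rnormC r : rnorm (r%:C%C : R[i]) = `|r|.
Proof. by apply: complexI; rewrite -normE normc_def /= expr0n addr0 sqrtr_sqr. Qed.

Lemma ripxx x : rip x x = rnorm x ^+ 2.
Proof.
by rewrite /rip ipxx normE -rmorphXn.
Qed.

Lemma ripxx_ge0 x : 0 <= rip x x.
Proof. by rewrite ripxx sqr_ge0. Qed.

Lemma rnormE x : rnorm x = Num.sqrt (rip x x).
Proof. by rewrite ripxx sqrtr_sqr ger0_norm ?rnorm_ge0. Qed.

Lemma ripDD x y : rip (x + y) (x + y) = rip x x + 2 * rip x y + rip y y.
Proof. by rewrite !(ripDl, ripDr) (ripC y x); ring. Qed.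

Lemma ripBB x y : rip (x - y) (x - y) = rip x x - 2 * rip x y + rip y y.
Proof. by rewrite ripDD !(ripNl, ripNr); ring. Qed.

Lemma rip_sqr_le x y : rip x y ^+ 2 <= rip x x * rip y y.
Proof. exact: dot_cauchy_schwarz. Qed.

Lemma rip_le x y : `|rip x y| <= rnorm x * rnorm y.
Proof.
rewrite -(@ler_pXn2r _ 2) ?nnegrE ?mulr_ge0 ?rnorm_ge0//.
by rewrite real_normK ?num_real// exprMn -!ripxx rip_sqr_le.
Qed.

Lemma rip_inj y z : (forall x, rip x y = rip x z) -> y = z.
Proof.
move=> h; apply/eqP; rewrite -subr_eq0; apply/eqP/rnorm0_eq0.
by rewrite rnormE ripDr ripNr !h subrr sqrtr0.
Qed.

End HilbertReal.

Lemma ip_rip_ext (R : realType) (H K : hilbertType R) (x y : H) (u v : K) :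
  rip x y = rip u v -> rip x ('i%C *: y) = rip u ('i%C *: v) -> ip x y = ip u v.
Proof. by rewrite !ipE => -> ->. Qed.

(** * Riesz representation and adjoints *)

Section Riesz.
Context {R : realType} {H : hilbertType R}.
Implicit Types (x y z : H) (r t C : R).

Lemma cauchy_rnorm_cvg (u : nat -> H) :
  (forall e : R, 0 < e -> exists N, forall m n, (N <= m)%N -> (N <= n)%N ->
     rnorm (u m - u n) < e) ->
  exists y, forall e : R, 0 < e -> exists N, forall n, (N <= n)%N ->
     rnorm (y - u n) < e.
Proof.
move=> cu.
have : cauchy (u @ \oo).
  apply/cauchy_ballP => e e0.
  have ee : e = (complex.Re e)%:C%C by rewrite RRe_real ?gtr0_real.
  have [|N hN] := cu (complex.Re e); first by rewrite -ltcR -ee.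
  exists (u @` [set n | (N <= n)%N], u @` [set n | (N <= n)%N]).
    by split; exists N => // n Nn; exists n.
  case=> a b [[m Nm <-] [n Nn <-]].
  by rewrite -ball_normE /ball_ /= normE ee ltcR; apply: hN.
move=> /cauchy_cvg /cvg_ex[y yu]; exists y => e e0.
have /cvgrPdist_lt := yu.
move=> /(_ e%:C%C); rewrite ltcR => /(_ e0) [N _ hN].
by exists N => n Nn; have := hN n Nn; rewrite /= normE ltcR.
Qed.

(* The representing vector minimises [x |-> |x|^2 - 2 g x]. *)
Lemma riesz_real (g : H -> R) C :
  (forall x y, g (x + y) = g x + g y) ->
  (forall r x, g (r%:C%C *: x) = r * g x) ->
  (forall x, g x <= C * rnorm x) ->
  exists y, forall x, g x = rip x y.
Proof.
move=> gD gZ gC.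
pose J x := rip x x - 2 * g x.
have JC x : - C ^+ 2 <= J x.
  rewrite /J ripxx; have := gC x; have := sqr_ge0 (rnorm x - C).
  by rewrite sqrrB; lra.
pose A := [set J x | x in [set: H]].
have Ainf : has_inf A.
  split; first by exists (J 0); exists 0.
  by exists (- C ^+ 2) => _ [x _ <-].
pose m := inf A.
have mJ x : m <= J x by apply: ge_inf; [case: Ainf|exists x].
(* Minimality of [m] along the line [x + t h] makes a quadratic polynomial in [t] nonnegative; its
   least value bounds how far an almost minimiser [x] is from representing [g] at [h]. *)
have optimal x h : (rip x h - g h) ^+ 2 <= (J x - m) * rip h h.
  have q t : 0 <= J x - m + 2 * t * (rip x h - g h) + t ^+ 2 * rip h h.
    have := mJ (x + t%:C%C *: h); rewrite /J ripDD gD gZ !(ripZl, ripZr); lra.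
  have [h0|/eqP h0] := eqVneq (rip h h) 0.
    have -> : h = 0 by apply: rnorm0_eq0; rewrite rnormE h0 sqrtr0.
    have -> : g 0 = 0 by have := gZ 0 0; rewrite scaler0 mul0r.
    by rewrite !rip0r subrr expr0n mulr0.
  have h_gt0 : 0 < rip h h by rewrite lt_def ripxx_ge0 andbT; apply/eqP.
  have := q (- (rip x h - g h) / rip h h).
  set a := rip x h - g h; set b := rip h h in h0 h_gt0 *.
  have -> : J x - m + 2 * (- a / b) * a + (- a / b) ^+ 2 * b = J x - m - a ^+ 2 / b.
    by field; apply/eqP.
  by rewrite subr_ge0 ler_pdivrMr.
have near_inf n : exists x, J x < m + n.+1%:R^-1.
  have [_ [x _ <-] hx] := @inf_adherent _ A n.+1%:R^-1 ltac:(by rewrite invr_gt0) Ainf.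
  by exists x.
have [u hu] := choice near_inf.
have harm (e : R) : 0 < e -> exists N, forall n, (N <= n)%N -> n.+1%:R^-1 < e :> R.
  move=> e0; exists (Num.trunc e^-1) => n Nn.
  rewrite invf_plt ?posrE//.
  by apply: lt_le_trans (truncnS_gt _) _; rewrite ler_nat ltnS.
(* By the parallelogram law and [m <= J] at the midpoint, [|u a - u b|^2] is at most
   [2 (J (u a) - m) + 2 (J (u b) - m)], whence the threshold [e ^+ 2 / 4]. *)
have [|y hy] := @cauchy_rnorm_cvg u.
  move=> e e0.
  have [|N hN] := harm (e ^+ 2 / 4); first by rewrite divr_gt0 ?exprn_gt0.
  exists N => a b Na Nb.
  rewrite -(@ltr_pXn2r _ 2) ?nnegrE ?rnorm_ge0 ?(ltW e0)// -ripxx ripBB.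
  have := mJ ((2^-1)%:C%C *: (u a + u b)).
  rewrite /J gZ gD !(ripZl, ripZr) ripDD.
  have := hu a; have := hu b; have := hN a Na; have := hN b Nb; rewrite /J.
  move: (a.+1%:R^-1) (b.+1%:R^-1) (e ^+ 2) => ia ib e2; lra.
exists y => h; apply/eqP; rewrite eq_sym -subr_eq0 -normr_eq0; apply/eqP.
apply/le_anti; rewrite normr_ge0 andbT.
apply/ler_addgt0Pr => e e0; rewrite add0r.
(* Two errors of size at most [d * rnorm h] must fit into [e]; the [1] covers [h = 0]. *)
have K0 : 0 < 2 * (rnorm h + 1) by have := rnorm_ge0 h; lra.
pose d := e / (2 * (rnorm h + 1)).
have d0 : 0 < d by rewrite divr_gt0.
have [N1 hN1] := hy _ d0.
have [|N2 hN2] := harm (d ^+ 2); first by rewrite exprn_gt0.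
pose k := maxn N1 N2.
have h1 : rnorm (y - u k) < d by apply: hN1; rewrite leq_maxl.
have h2 : J (u k) - m <= d ^+ 2.
  have := hN2 k (leq_maxr _ _); have := hu k.
  by move: (k.+1%:R^-1) (d ^+ 2) => ik d2; lra.
have h3 : `|rip (u k) h - g h| <= d * rnorm h.
  have dh0 : 0 <= d * rnorm h := mulr_ge0 (ltW d0) (rnorm_ge0 h).
  rewrite -(@ler_pXn2r _ 2) ?nnegrE//.
  rewrite real_normK ?num_real// exprMn -ripxx.
  by apply: le_trans (optimal _ _) _; rewrite ler_wpM2r ?ripxx_ge0.
have h4 : `|rip (y - u k) h| <= d * rnorm h.
  by apply: le_trans (rip_le _ _) _; rewrite ler_wpM2r ?rnorm_ge0 ?ltW.
have -> : rip h y - g h = rip (y - u k) h + (rip (u k) h - g h).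
  by rewrite ripDl ripNl (ripC h y); ring.
apply: le_trans (ler_normD _ _) _; apply: le_trans (lerD h4 h3) _.
have -> : e = d * (2 * (rnorm h + 1)) by rewrite /d; field; move: (rnorm_ge0 h) => ?; lra.
by rewrite -mulrDr ler_wpM2l ?(ltW d0)//; lra.
Qed.

End Riesz.

Section Adjoint.
Context {R : realType} {H K : hilbertType R}.

Lemma adjoint_exists (A : {linear H -> K}) (C : R) :
  (forall x, rnorm (A x) <= C * rnorm x) ->
  exists B : K -> H, forall x y, ip (A x) y = ip x (B y).
Proof.
move=> AC.
suff /choice[B hB] : forall y, exists b, forall x, rip (A x) y = rip x b.
  exists B => x y; apply: ip_rip_ext => //.
  have e u v : rip u ('i%C *: v) = - rip ('i%C *: u) v.
    by rewrite -[in RHS]ripi scaleii ripNl opprK.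
  by rewrite !e -linearZ hB.
move=> y.
apply: (@riesz_real _ _ (fun x => rip (A x) y) (C * rnorm y)).
- by move=> u v; rewrite linearD ripDl.
- by move=> r u; rewrite linearZ ripZl.
- move=> x; apply: le_trans (ler_norm _) _; apply: le_trans (rip_le _ _) _.
  by rewrite mulrAC ler_wpM2r ?rnorm_ge0.
Qed.

Lemma adjoint_linear (A : {linear H -> K}) (B : K -> H) :
  (forall x y, ip (A x) y = ip x (B y)) ->
  {L : {linear K -> H} | forall y, L y = B y}.
Proof.
move=> AB.
have Blin : linear B.
  move=> a u v; apply: rip_inj => x; rewrite /rip.
  by rewrite -AB !linearPr /= !AB.
pose L := GRing.isLinear.Build _ _ _ _ B Blin.
pose L' : {linear K -> H} := HB.pack B L.
by exists L'.
Qed.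

End Adjoint.

(** On [[0, 1]] the defect [g f - f * g 1] is bounded by a constant. At the fractional part of [N t]
    it equals [N (g t - t * g 1)], and [N] can be taken arbitrarily large. *)
Lemma additive_bounded_linear (R : realType) (g : R -> R) (A B : R) :
  (forall s t, g (s + t) = g s + g t) ->
  (forall t, `|g t| <= A * t ^+ 2 + B) ->
  forall t, g t = t * g 1.
Proof.
move=> gD gB t.
have gMn n s : g (n%:R * s) = n%:R * g s.
  elim: n => [|n IH].
    by rewrite !mul0r; have := gD 0 0; rewrite addr0; lra.
  by rewrite -natr1 !mulrDl gD IH !mul1r.
have gN s : g (- s) = - g s.
  by have := gD s (- s); have := gMn 0%N 0; rewrite subrr !mul0r; lra.
have gZ (z : int) : g z%:~R = z%:~R * g 1.
  case: z => n; first by rewrite -pmulrn -[X in g X]mulr1 gMn.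
  by rewrite NegzE mulrNz -pmulrn gN -[X in g X]mulr1 gMn mulNr.
apply/eqP; rewrite -subr_eq0 -normr_eq0; apply/eqP/le_anti.
rewrite normr_ge0 andbT; apply/ler_addgt0Pr => e e0; rewrite add0r.
pose C := `|A| + `|B| + `|g 1|.
pose N := (Num.trunc (C / e)).+1.
have N_gt : C / e < N%:R by exact: truncnS_gt.
have N0 : 0 < N%:R :> R by rewrite ltr0n.
pose f := N%:R * t - (Num.floor (N%:R * t))%:~R.
have f0 : 0 <= f by rewrite subr_ge0 floor_le_tmp.
have f1 : f <= 1 by rewrite lerBlDl ltW// -[X in _ + X]/(1%:~R) -intrD1 floorD1_gt.
have eqf : N%:R * (g t - t * g 1) = g f - f * g 1.
  by rewrite /f gD gN gMn gZ; ring.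
have : `|g f - f * g 1| <= C.
  apply: le_trans (ler_normB _ _) _; rewrite /C normrM (ger0_norm f0).
  apply: lerD; last by rewrite ler_piMl.
  apply: le_trans (gB _) _; apply: lerD; last exact: ler_norm.
  apply: le_trans (ler_norm _) _; rewrite normrM ler_piMr//.
  by rewrite ger0_norm ?exprn_ge0// exprn_ile1.
rewrite -eqf normrM (gtr0_norm N0) => h.
rewrite -(ler_pM2l N0); apply: le_trans h _.
by rewrite -ler_pdivrMr// ltW.
Qed.

(** * The Jordan-von Neumann theorem *)

Section JordanVonNeumann.
Context {R : realType} {V : lmodType R[i]} (Q : V -> R).
Hypothesis Q_ge0 : forall x, 0 <= Q x.
Hypothesis QZ : forall (c : R[i]) x,
  Q (c *: x) = (complex.Re c ^+ 2 + complex.Im c ^+ 2) * Q x.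
Hypothesis Q_parallelogram : forall x y,
  Q (x + y) + Q (x - y) = 2 * Q x + 2 * Q y.
Hypothesis Q_eq0 : forall x, Q x = 0 -> x = 0.

Let S x y := Q (x + y) - Q (x - y).

Let QN x : Q (- x) = Q x.
Proof. rewrite -scaleN1r QZ (_ : _ + _ = 1) ?mul1r// -[RHS]addr0.
by congr (_ + _); rewrite /= ?oppr0 ?sqrrN ?expr1n ?expr0n. Qed.

Let Q0 : Q 0 = 0.
Proof. by have := Q_parallelogram 0 0; rewrite subrr addr0; lra. Qed.

Let SC x y : S x y = S y x.
Proof. by rewrite /S (addrC y) -(QN (y - x)) opprB. Qed.

Let S0 y : S 0 y = 0.
Proof. by rewrite /S add0r sub0r QN subrr. Qed.

Let S_mid u v w : S (u + w) v + S (u - w) v = 2 * S u v.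
Proof.
have h1 := Q_parallelogram (u + v) w; have h2 := Q_parallelogram (u - v) w.
rewrite /S (addrAC u w v) (addrAC u w (- v)) (addrAC u (- w) v) (addrAC u (- w) (- v)).
lra.
Qed.

(** With [a = u + w] and [b = u - w], [S_mid] gives [S a v + S b v = 2 S u v], and its case [w = u]
    turns the right side into [S (u + u) v]. *)
Let SDl a b v : S (a + b) v = S a v + S b v.
Proof.
have S2 u : S (u + u) v = 2 * S u v.
  by have := S_mid u v u; rewrite subrr S0 addr0.
pose u := (2^-1 : R[i]) *: (a + b); pose w := (2^-1 : R[i]) *: (a - b).
have half x : (2^-1 : R[i]) *: x + (2^-1 : R[i]) *: x = x.
  by rewrite -scalerDl -mulr2n -(mulr_natr 2^-1) mulVf ?scale1r// pnatr_eq0.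
have <- : u + w = a.
  by rewrite /u /w -scalerDr addrACA subrr addr0 scalerDr half.
have <- : u - w = b.
  by rewrite /u /w -scalerBr opprB addrC addrA subrK scalerDr half.
by rewrite S_mid [X in S X _](_ : _ = u + u) ?S2// addrACA subrr addr0.
Qed.

Let SZl (r : R) u v : S (r%:C%C *: u) v = r * S u v.
Proof.
rewrite (@additive_bounded_linear R (fun r => S (r%:C%C *: u) v) (2 * Q u) (2 * Q v)).
- by rewrite scale1r.
- by move=> s t; rewrite rmorphD scalerDl SDl.
move=> t; rewrite /S.
have -> : 2 * Q u * t ^+ 2 = 2 * Q (t%:C%C *: u) by rewrite QZ /= expr0n addr0; ring.
have := Q_parallelogram (t%:C%C *: u) v.
have := Q_ge0 (t%:C%C *: u + v); have := Q_ge0 (t%:C%C *: u - v).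
by rewrite ler_norml; move=> *; apply/andP; split; lra.
Qed.

Let Si x y : S ('i%C *: x) y = - S x ('i%C *: y).
Proof.
have Qi u : Q ('i%C *: u) = Q u by rewrite QZ /= expr0n expr1n add0r mul1r.
have e1 : 'i%C *: x + y = 'i%C *: (x - 'i%C *: y) by rewrite scalerBr scaleii opprK.
have e2 : 'i%C *: x - y = 'i%C *: (x + 'i%C *: y) by rewrite scalerDr scaleii.
by rewrite /S e1 e2 !Qi opprB.
Qed.

(** [S] is four times the real part of the inner product sought; the imaginary part is then forced
    as in [ipE]. *)
Definition polar x y : R[i] := ((S x y / 4) +i* (S x ('i%C *: y) / 4))%C.

Let polarC x y : polar x y = (-1) ^+ false * Num.conj (polar y x).
Proof.
rewrite mul1r; apply/eqP; rewrite eq_complex /= SC eqxx /=.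
by rewrite [S y _]SC Si mulNr opprK.
Qed.

Let polarl_add y : zmod_morphism (polar ^~ y).
Proof.
have SN a b : S (- a) b = - S a b.
  by have := SDl a (- a) b; rewrite subrr S0; lra.
move=> a b; apply/eqP; rewrite eq_complex /= !SDl !SN.
by apply/andP; split; apply/eqP; lra.
Qed.

Let polarl_scale y : scalable_for *%R (polar ^~ y).
Proof.
move=> c x; rewrite {1}[c]complexRK scalerDl mulrC -scalerA.
have -> : polar ((complex.Re c)%:C%C *: x + (complex.Im c)%:C%C *: ('i%C *: x)) y =
   (c * polar x y).
  case: c => a b; apply/eqP; rewrite eq_complex /= !SDl !SZl !Si scaleii.
  rewrite [S x (- y)]SC.
  have -> : S (- y) x = - S x y.
    by have := SDl y (- y) x; rewrite subrr S0 (SC y); lra.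
  by apply/andP; split; apply/eqP; lra.
by [].
Qed.

Let polarr_add x : zmod_morphism (polar x).
Proof.
move=> a b; rewrite polarC mul1r (polarl_add x) rmorphB /=.
by rewrite (polarC x a) (polarC x b) !mul1r.
Qed.

Let polarr_scale x : scalable_for (Num.conj \; *%R) (polar x).
Proof.
move=> c y; rewrite polarC mul1r (polarl_scale x) rmorphM /=.
by rewrite (polarC x y) mul1r.
Qed.

Let polarxx x : polar x x = (Q x)%:C%C.
Proof.
have e : S x x = 4 * Q x.
  rewrite /S subrr Q0 subr0; have := Q_parallelogram x x.
  by rewrite subrr Q0 addr0; lra.
have e' : S x ('i%C *: x) = 0 by have := Si x x; rewrite SC; lra.
by rewrite /polar e e' mul0r; congr Complex; lra.
Qed.

Let polar_gt0 x : x != 0 -> 0 < polar x x.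
Proof.
move=> x0; rewrite polarxx ltcR lt_def Q_ge0 andbT.
by apply: contra_neq x0 => /Q_eq0.
Qed.

Lemma jordan_von_neumann : {f : {dot V for Num.conj} | f = polar :> (V -> V -> R[i])}.
Proof.
pose B := isBilinear.Build _ _ _ _ _ _ polar polarl_add polarr_add polarl_scale polarr_scale.
pose Hm := isHermitianSesquilinear.Build _ _ false Num.conj polar polarC.
pose D := isDotProduct.Build _ _ polar polar_gt0.
pose f : {dot V for Num.conj} := HB.pack polar B Hm D.
by exists f.
Qed.

Lemma polar_diag x : polar x x = (Q x)%:C%C. Proof. exact: polarxx. Qed.

End JordanVonNeumann.

(** * The reproducing kernel Hilbert space of a positive kernel *)

Record psd_kernel (R : realType) (X : Type) := PsdKernel {
  kfun :> X -> X -> R[i];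
  kfunC : forall x y, kfun y x = Num.conj (kfun x y);
  kfun_psd : forall l : seq (R[i] * X),
    0 <= complex.Re (\sum_(p <- l) \sum_(q <- l)
                       p.1 * Num.conj q.1 * kfun p.2 q.2) }.

Section FormalSums.
Context {R : realType} {X : Type} (k : psd_kernel R X).
Implicit Types (l m : seq (R[i] * X)) (phi psi : X -> R[i]) (c : R[i]).
Local Notation Re := (@complex.Re R).
Local Notation Im := (@complex.Im R).

(** A formal sum stands for a combination of kernel functions; by the reproducing property this is
    [<phi, l>], hence the conjugate. *)
Definition fev phi l := \sum_(p <- l) Num.conj p.1 * phi p.2.
Definition fscale c l := [seq (c * p.1, p.2) | p <- l].
Definition flin l : X -> R[i] := fun y => \sum_(p <- l) p.1 * k p.2 y.
Definition gram l m := fev (flin l) m.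
Definition qf l := Re (gram l l).

Lemma fev_cat phi l m : fev phi (l ++ m) = fev phi l + fev phi m.
Proof. exact: big_cat. Qed.

Lemma fev_scale phi c l : fev phi (fscale c l) = Num.conj c * fev phi l.
Proof.
rewrite /fev big_map mulr_sumr; apply: eq_bigr => p _ /=.
by rewrite rmorphM mulrA.
Qed.

Lemma fevD phi psi l : fev (phi + psi) l = fev phi l + fev psi l.
Proof. by rewrite /fev -big_split; apply: eq_bigr => p _; rewrite mulrDr. Qed.

Lemma fevZ c phi l : fev (c *: phi) l = c * fev phi l.
Proof. by rewrite /fev mulr_sumr; apply: eq_bigr => p _; rewrite mulrCA. Qed.

Lemma fevB phi psi l : fev (phi - psi) l = fev phi l - fev psi l.
Proof. by rewrite -scaleN1r fevD fevZ mulN1r. Qed.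

Lemma flin_cat l m : flin (l ++ m) = flin l + flin m.
Proof. by apply/funext => y; rewrite /flin big_cat. Qed.

Lemma flin_scale c l : flin (fscale c l) = c *: flin l.
Proof.
apply/funext => y; rewrite /flin big_map [RHS]mulr_sumr.
by apply: eq_bigr => p _; rewrite /= mulrA.
Qed.

Lemma gramE l m :
  gram l m = \sum_(p <- l) \sum_(q <- m) p.1 * Num.conj q.1 * k p.2 q.2.
Proof.
rewrite /gram /fev exchange_big /=; apply: eq_bigr => q _.
by rewrite /flin mulr_sumr; apply: eq_bigr => p _; rewrite mulrCA mulrA.
Qed.

Lemma gramC l m : gram m l = Num.conj (gram l m).
Proof.
rewrite !gramE exchange_big rmorph_sum; apply: eq_bigr => p _ /=.
rewrite rmorph_sum; apply: eq_bigr => q _.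
by rewrite !rmorphM /= conjCK (kfunC k p.2) [_ * Num.conj p.1]mulrC.
Qed.

Lemma qf_ge0 l : 0 <= qf l.
Proof. by rewrite /qf gramE; apply: kfun_psd. Qed.

Lemma qf_cat l m : qf (l ++ m) = qf l + 2 * Re (gram l m) + qf m.
Proof.
rewrite /qf {1}/gram flin_cat fevD !fev_cat -!/(gram _ _) !ReD.
by rewrite (gramC l m) ReJ; lra.
Qed.

Lemma qf_scale c l : qf (fscale c l) = (Re c ^+ 2 + Im c ^+ 2) * qf l.
Proof.
rewrite /qf /gram flin_scale fevZ fev_scale mulrA -ReZ; congr (Re (_ * _)).
by case: c => a b; apply/eqP; rewrite eq_complex /=; apply/andP; split; apply/eqP; ring.
Qed.

Lemma gram_scaler c l m : gram l (fscale c m) = Num.conj c * gram l m.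
Proof. exact: fev_scale. Qed.

(* The supremum over [l] of this expression is the squared norm of the
   functional [l |-> fev phi l], measured against [qf]. *)
Definition dualval phi l := 2 * Re (fev phi l) - qf l.

Definition kbounded : {pred X -> R[i]} :=
  fun phi => `[< exists C, forall l, dualval phi l <= C >].

Lemma kboundedP phi : reflect (exists C, forall l, dualval phi l <= C)
  (phi \in kbounded).
Proof. exact: asboolP. Qed.

Definition ksq phi : R := sup [set dualval phi l | l in [set: seq (R[i] * X)]].

Lemma dualval_nil phi : dualval phi [::] = 0.
Proof. by rewrite /dualval /qf /gram /fev !big_nil /= mulr0 subr0. Qed.

Lemma ksq_ub phi l : phi \in kbounded -> dualval phi l <= ksq phi.
Proof.
by move=> /kboundedP[C hC]; apply: ub_le_sup; [exists C => _ [m _ <-]|exists l].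
Qed.

Lemma ksq_le phi C : (forall l, dualval phi l <= C) -> ksq phi <= C.
Proof.
by move=> hC; apply: ge_sup; [exists (dualval phi [::]), [::] | move=> _ [l _ <-]].
Qed.

Lemma ksq_ge0 phi : phi \in kbounded -> 0 <= ksq phi.
Proof. by move=> /(ksq_ub [::]); rewrite dualval_nil. Qed.

Let sumsq_i0 c : c != 0 -> Re c ^+ 2 + Im c ^+ 2 != 0.
Proof.
case: c => a b; rewrite eq_complex /= negb_and => h.
by rewrite paddr_eq0 ?sqr_ge0// !sqrf_eq0 negb_and.
Qed.

Lemma dualvalZ c phi l : dualval (c *: phi) (fscale c l) =
  (Re c ^+ 2 + Im c ^+ 2) * dualval phi l.
Proof.
rewrite /dualval qf_scale fevZ fev_scale mulrA.
have -> : c * Num.conj c = (Re c ^+ 2 + Im c ^+ 2)%:C%C.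
  by case: c => a b; apply/eqP; rewrite eq_complex /=; apply/andP; split; apply/eqP; ring.
by rewrite ReZ; ring.
Qed.

Lemma fscaleA c d l : fscale c (fscale d l) = fscale (c * d) l.
Proof. by rewrite /fscale -map_comp; apply: eq_map => p /=; rewrite mulrA. Qed.

Lemma fscale1 l : fscale 1 l = l.
Proof. by rewrite -[RHS]map_id; apply: eq_map => -[a x] /=; rewrite mul1r. Qed.

Let ksqZ_le c phi l : c != 0 -> phi \in kbounded ->
  dualval (c *: phi) l <= (Re c ^+ 2 + Im c ^+ 2) * ksq phi.
Proof.
move=> c0 bphi; rewrite -[l]fscale1 -(mulfV c0) -fscaleA dualvalZ.
by rewrite ler_wpM2l ?addr_ge0 ?sqr_ge0// ksq_ub.
Qed.

Let dualval0 l : dualval 0 l <= 0.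
Proof.
rewrite /dualval /fev big1 ?Re0 ?mulr0 ?sub0r ?oppr_le0 ?qf_ge0//.
by move=> p _; rewrite mulr0.
Qed.

Lemma kbounded0 : 0 \in kbounded.
Proof. by apply/kboundedP; exists 0. Qed.

Lemma kboundedZ c phi : phi \in kbounded -> c *: phi \in kbounded.
Proof.
have [->|c0] := eqVneq c 0; first by rewrite scale0r kbounded0.
by move=> bphi; apply/kboundedP; eexists => l; apply: ksqZ_le.
Qed.

Lemma ksqZ c phi : phi \in kbounded ->
  ksq (c *: phi) = (Re c ^+ 2 + Im c ^+ 2) * ksq phi.
Proof.
move=> bphi; have [->|c0] := eqVneq c 0.
  rewrite scale0r expr0n addr0 mul0r; apply/le_anti.
  by rewrite ksq_le//= ksq_ge0// kbounded0.
apply/le_anti/andP; split; first by apply: ksq_le => l; apply: ksqZ_le.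
have cV0 : c^-1 != 0 by rewrite invr_eq0.
have := @ksq_le phi ((Re c^-1 ^+ 2 + Im c^-1 ^+ 2) * ksq (c *: phi)).
rewrite -{1}[phi]scale1r -(mulVf c0) -scalerA.
have h l := @ksqZ_le c^-1 (c *: phi) l cV0 (kboundedZ c bphi).
move=> /(_ h).
have -> : Re c^-1 ^+ 2 + Im c^-1 ^+ 2 = (Re c ^+ 2 + Im c ^+ 2)^-1.
  have := sumsq_i0 c0; case: (c) => a b /=; set s := _ + _ => s0.
  rewrite sqrrN !expr_div_n -mulrDl -/s; field.
  by [].
by rewrite ler_pdivlMl// lt_def sumsq_i0//= addr_ge0 ?sqr_ge0.
Qed.

Let half := (2^-1 : R)%:C%C.

Let qf_half l m : 2 * qf (fscale half (l ++ m)) +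
  2 * qf (fscale half (l ++ fscale (-1)%:C%C m)) = qf l + qf m.
Proof.
rewrite !qf_scale !qf_cat gram_scaler qf_scale.
rewrite (_ : Num.conj (-1)%:C%C = (-1)%:C%C); last exact: conjc_real.
by rewrite ReZ /=; lra.
Qed.

(** Testing [phi + psi] with [l] and [phi - psi] with [m] amounts to testing [phi] with
    [(l + m) / 2] and [psi] with [(l - m) / 2]. Suprema over independent [l] and [m] give one half
    of the parallelogram law for [ksq]. *)
Lemma dualval_parallelogram phi psi l m :
  dualval (phi + psi) l + dualval (phi - psi) m =
  2 * dualval phi (fscale half (l ++ m)) +
  2 * dualval psi (fscale half (l ++ fscale (-1)%:C%C m)).
Proof.
rewrite /dualval !mulrBr.
rewrite [RHS](_ : _ = 2 * (2 * Re (fev phi (fscale half (l ++ m)))) +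
  2 * (2 * Re (fev psi (fscale half (l ++ fscale (-1)%:C%C m)))) - (qf l + qf m)).
  rewrite !fev_scale !fev_cat fev_scale fevD fevB.
  have conjR (r : R) : Num.conj r%:C%C = r%:C%C by apply: conjc_real.
  by rewrite !conjR !ReZ !ReD ReZ ReN; lra.
by rewrite -qf_half; lra.
Qed.

Lemma kboundedD phi psi : phi \in kbounded -> psi \in kbounded ->
  phi + psi \in kbounded.
Proof.
move=> bphi bpsi; apply/kboundedP; exists (2 * ksq phi + 2 * ksq psi) => l.
rewrite -[leLHS]addr0 -(dualval_nil (phi - psi)) dualval_parallelogram.
by rewrite lerD// ler_wpM2l// ksq_ub.
Qed.

Lemma kboundedB phi psi : phi \in kbounded -> psi \in kbounded ->
  phi - psi \in kbounded.
Proof. by move=> bphi bpsi; rewrite kboundedD// -scaleN1r kboundedZ. Qed.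

Let ksq_parallelogram_le phi psi : phi \in kbounded -> psi \in kbounded ->
  ksq (phi + psi) + ksq (phi - psi) <= 2 * ksq phi + 2 * ksq psi.
Proof.
move=> bphi bpsi; rewrite -lerBrDr; apply: ksq_le => l.
rewrite lerBrDr addrC -lerBrDr; apply: ksq_le => m.
rewrite lerBrDr addrC dualval_parallelogram.
by rewrite lerD// ler_wpM2l// ksq_ub.
Qed.

(** The reverse inequality is the first one for [phi + psi] and [phi - psi], whose sum and
    difference are [2 phi] and [2 psi]. *)
Lemma ksq_parallelogram phi psi : phi \in kbounded -> psi \in kbounded ->
  ksq (phi + psi) + ksq (phi - psi) = 2 * ksq phi + 2 * ksq psi.
Proof.
move=> bphi bpsi; apply/le_anti; rewrite ksq_parallelogram_le//=.
have := ksq_parallelogram_le (kboundedD bphi bpsi) (kboundedB bphi bpsi).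
rewrite addrACA subrr addr0 opprB [phi + psi + _]addrC addrA subrK.
have two (chi : X -> R[i]) : chi + chi = 2%:C%C *: chi.
  by rewrite -mulr2n -scaler_nat rmorph_nat.
by rewrite !two !ksqZ//= expr0n addr0; lra.
Qed.

Lemma ksq_eq0 phi : phi \in kbounded -> ksq phi = 0 -> phi = 0.
Proof.
move=> bphi phi0; apply/funext => x.
have h (t : R) := ksq_ub [:: (t%:C%C * phi x, x)] bphi.
pose b := qf [:: (1, x)].
have b0 : 0 <= b := qf_ge0 _.
pose n := Re (phi x) ^+ 2 + Im (phi x) ^+ 2.
have n0 : 0 <= n by rewrite addr_ge0 ?sqr_ge0.
have e t : dualval phi [:: (t%:C%C * phi x, x)] = 2 * t * n - t ^+ 2 * n * b.
  rewrite /dualval /fev big_seq1 /=.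
  rewrite (_ : [:: _] = fscale (t%:C%C * phi x) [:: (1, x)]); last first.
    by rewrite /= mulr1.
  rewrite qf_scale -/b /n; case: (phi x) => u v /=.
  by rewrite !mul0r !addr0 !subr0; ring.
(* A small [t > 0] makes [2 t n - t^2 n b] positive unless [n = 0]; [1 / (b + 1)] is small enough,
   also when [b = 0]. *)
have := h (b + 1)^-1; rewrite e phi0.
have b1 : b + 1 != 0 by rewrite gt_eqF//; lra.
rewrite (_ : _ - _ = n * ((b + 2) / (b + 1) ^+ 2)); last by field.
rewrite pmulr_lle0 ?divr_gt0 ?exprn_gt0//; [|lra|lra].
move=> n_le0; have : n = 0 by apply/le_anti; rewrite n_le0.
move/eqP; rewrite /n paddr_eq0 ?sqr_ge0// !sqrf_eq0 => /andP[/eqP u0 /eqP v0].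
by apply/eqP; rewrite eq_complex u0 v0 !eqxx.
Qed.

(** Completing the square: adding the kernel combination of [l] moves the test sum from [m] to
    [m - l], up to a constant independent of [m]. This bounds [ksq], and the same bound for [- l]
    makes it an equality in [ksq_flinD]. *)
Lemma dualval_flinD phi l m : dualval (phi + flin l) m =
  dualval phi (m ++ fscale (-1)%:C%C l) + 2 * Re (fev phi l) + qf l.
Proof.
rewrite /dualval qf_cat fev_cat fevD gram_scaler fev_scale qf_scale.
rewrite (_ : Num.conj (-1)%:C%C = (-1)%:C%C); last exact: conjc_real.
by rewrite -/(gram _ _) (gramC m l) !ReD !ReZ ReJ /=; lra.
Qed.

Lemma kbounded_flin l : flin l \in kbounded.
Proof.
apply/kboundedP; exists (qf l) => m; rewrite -[flin l]add0r dualval_flinD.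
have := dualval0 (m ++ fscale (-1)%:C%C l).
have -> : fev 0 l = 0 by rewrite /fev big1// => p _; rewrite mulr0.
by rewrite Re0; lra.
Qed.

Let ksq_flinD_le phi l : phi \in kbounded ->
  ksq (phi + flin l) <= ksq phi + 2 * Re (fev phi l) + qf l.
Proof.
by move=> bphi; apply: ksq_le => m; rewrite dualval_flinD !lerD// ksq_ub.
Qed.

Lemma ksq_flinD phi l : phi \in kbounded ->
  ksq (phi + flin l) = ksq phi + 2 * Re (fev phi l) + qf l.
Proof.
move=> bphi; apply/le_anti; rewrite ksq_flinD_le//=.
have := @ksq_flinD_le (phi + flin l) (fscale (-1)%:C%C l) (kboundedD bphi (kbounded_flin l)).
rewrite flin_scale (_ : (-1)%:C%C *: flin l = - flin l); last first.
  by rewrite rmorphN rmorph1 scaleN1r.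
rewrite addrK fev_scale fevD -/(gram _ _) qf_scale.
rewrite (_ : Num.conj (-1)%:C%C = (-1)%:C%C); last exact: conjc_real.
by rewrite ReZ ReD -/(qf _) /=; lra.
Qed.

End FormalSums.

Record rkhs (R : realType) (X : Type) (k : psd_kernel R X) := Rkhs {
  rk_val :> X -> R[i];
  _ : rk_val \in kbounded k }.

Section RkhsModule.
Context {R : realType} {X : Type} (k : psd_kernel R X).

HB.instance Definition _ := [isSub for @rk_val R X k].
HB.instance Definition _ := [Choice of rkhs k by <:].

Lemma kbounded_submod : GRing.submod_closed (kbounded k).
Proof.
split; first exact: kbounded0.
by move=> a u v bu bv; rewrite kboundedD// kboundedZ.
Qed.

HB.instance Definition _ := GRing.isSubmodClosed.Build _ _ (kbounded k)
  kbounded_submod.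
HB.instance Definition _ := [SubChoice_isSubLmodule of rkhs k by <:].

End RkhsModule.

Section RkhsNorm.
Context {R : realType} {X : Type} {k : psd_kernel R X}.
Implicit Types (f g : rkhs k) (l : seq (R[i] * X)).

Lemma rk_bounded f : (f : X -> R[i]) \in kbounded k.
Proof. exact: valP. Qed.

Lemma rk_valD f g : (f + g : rkhs k) = (f : X -> R[i]) + g :> (X -> R[i]).
Proof. by []. Qed.

Lemma rk_valB f g : (f - g : rkhs k) = (f : X -> R[i]) - g :> (X -> R[i]).
Proof. by []. Qed.

Lemma rk_ext f g : (forall x, f x = g x) -> f = g.
Proof. by move=> h; apply/val_inj/funext. Qed.

Definition rkQ f := ksq k f.

Lemma rkQ_ge0 f : 0 <= rkQ f. Proof. exact/ksq_ge0/rk_bounded. Qed.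

Lemma rkQZ (c : R[i]) f :
  rkQ (c *: f) = (complex.Re c ^+ 2 + complex.Im c ^+ 2) * rkQ f.
Proof. exact/ksqZ/rk_bounded. Qed.

Lemma rkQ_parallelogram f g : rkQ (f + g) + rkQ (f - g) = 2 * rkQ f + 2 * rkQ g.
Proof. exact: ksq_parallelogram (rk_bounded f) (rk_bounded g). Qed.

Lemma rkQ_eq0 f : rkQ f = 0 -> f = 0.
Proof. by move=> /(ksq_eq0 (rk_bounded f)) f0; apply: val_inj. Qed.

Definition rk_ip : {dot rkhs k for Num.conj} :=
  projT1 (jordan_von_neumann rkQ_ge0 rkQZ rkQ_parallelogram rkQ_eq0).

Lemma rk_ipE : rk_ip = polar rkQ :> (rkhs k -> rkhs k -> R[i]).
Proof. exact: (projT2 (jordan_von_neumann rkQ_ge0 rkQZ rkQ_parallelogram rkQ_eq0)). Qed.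

Lemma rk_ipxx f : rk_ip f f = (rkQ f)%:C%C.
Proof. by rewrite rk_ipE; apply: polar_diag rkQZ rkQ_parallelogram f. Qed.

Definition rk_norm f : R[i] := (Num.sqrt (rkQ f))%:C%C.

Lemma rk_normD f g : rk_norm (f + g) <= rk_norm f + rk_norm g.
Proof.
rewrite /rk_norm -rmorphD lecR.
rewrite -(@ler_pXn2r _ 2) ?nnegrE ?addr_ge0 ?sqrtr_ge0//.
rewrite sqrrD !sqr_sqrtr ?rkQ_ge0//.
have -> : rkQ (f + g) = rkQ f + 2 * complex.Re (rk_ip f g) + rkQ g.
  have e u : rkQ u = complex.Re (rk_ip u u) by rewrite rk_ipxx.
  by rewrite !e (hnormD rk_ip) mul1r !ReD ReJ; lra.
suff : complex.Re (rk_ip f g) <= Num.sqrt (rkQ f) * Num.sqrt (rkQ g).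
  by rewrite mulr2n; lra.
apply: le_trans (ler_norm _) _.
rewrite -(@ler_pXn2r _ 2) ?nnegrE ?mulr_ge0 ?sqrtr_ge0//.
rewrite real_normK ?num_real// exprMn !sqr_sqrtr ?rkQ_ge0//.
by have := dot_cauchy_schwarz rk_ip f g; rewrite !rk_ipxx.
Qed.

Lemma rk_normZ (c : R[i]) f : rk_norm (c *: f) = `|c| * rk_norm f.
Proof.
rewrite /rk_norm rkQZ sqrtrM ?addr_ge0 ?sqr_ge0// normc_def rmorphM.
by [].
Qed.

Lemma rk_norm0_eq0 f : rk_norm f = 0 -> f = 0.
Proof.
move=> /complexI /eqP; rewrite sqrtr_eq0 => f0; apply: rkQ_eq0.
by apply/le_anti; rewrite f0 rkQ_ge0.
Qed.

HB.instance Definition _ :=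
  Lmodule_isNormed.Build R[i] (rkhs k) rk_normD rk_normZ rk_norm0_eq0.

Lemma rk_rnormE f : rnorm f = Num.sqrt (rkQ f).
Proof. by []. Qed.

Definition rk_lin l : rkhs k := Rkhs (kbounded_flin k l).

(** Both [ksq_flinD] and the inner product expand the squared norm of [f + rk_lin l]; the cross
    terms must agree. *)
Lemma rk_ip_lin f l : complex.Re (rk_ip f (rk_lin l)) = complex.Re (fev f l).
Proof.
have e u : rkQ u = complex.Re (rk_ip u u) by rewrite rk_ipxx.
have := e (f + rk_lin l).
have -> : rkQ (f + rk_lin l) = rkQ f + 2 * complex.Re (fev f l) + rkQ (rk_lin l).
  rewrite /rkQ rk_valD ksq_flinD ?rk_bounded//; congr (_ + _ + _).
  have := ksq_flinD l (kbounded0 k).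
  have z0 : ksq k 0 = 0.
    by have := ksqZ 0 (kbounded0 k); rewrite scale0r expr0n addr0 mul0r.
  rewrite add0r z0 (_ : fev 0 l = 0) ?Re0 ?mulr0 ?add0r//.
  by rewrite /fev big1// => p _; rewrite mulr0.
by rewrite (hnormD rk_ip) mul1r !ReD ReJ -!e; lra.
Qed.

Lemma fev_le f l : `|complex.Re (fev f l)| <= rnorm f * rnorm (rk_lin l).
Proof.
rewrite -rk_ip_lin -(@ler_pXn2r _ 2) ?nnegrE ?mulr_ge0 ?rnorm_ge0//.
rewrite real_normK ?num_real// exprMn !rk_rnormE !sqr_sqrtr ?rkQ_ge0//.
by have := dot_cauchy_schwarz rk_ip f (rk_lin l); rewrite !rk_ipxx.
Qed.

Lemma fev_cvg (F : set_system (rkhs k)) : ProperFilter F -> cauchy F ->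
  exists phi : X -> R[i], forall l,
    complex.Re (fev (g : rkhs k) l) @[g --> F] --> complex.Re (fev phi l).
Proof.
move=> FF cF.
have cv l : cvg (complex.Re (fev (g : rkhs k) l) @[g --> F]).
  apply: R_complete; apply/cauchyP => e e0.
  pose d := e / (rnorm (rk_lin l) + 1).
  have n1 : 0 < rnorm (rk_lin l) + 1 by have := rnorm_ge0 (rk_lin l); lra.
  have d0 : 0 < d%:C%C :> R[i] by rewrite ltcR divr_gt0.
  have /cauchyP /(_ _ d0) [g Fg] := cF.
  exists (complex.Re (fev g l)).
  apply: (@filterS _ F _ (ball g d%:C%C) _ _ Fg) => h; rewrite -!ball_normE /ball_ /= normE ltcR => gh.
  rewrite -ReB -fevB -rk_valB; apply: le_lt_trans (fev_le _ _) _.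
  apply: le_lt_trans (_ : d * rnorm (rk_lin l) < _).
    by rewrite ler_wpM2r ?rnorm_ge0 ?ltW.
  rewrite -[ltRHS](divfK (lt0r_neq0 n1)) -/d ltr_pM2l; last by rewrite -ltcR.
  by lra.
(* Because [fev] conjugates, the pairing with ['i] at [x] has real part [Im (f x)]; real limits
   therefore determine [phi]. *)
pose c1 (x : X) := [:: (1 : R[i], x)]; pose ci (x : X) := [:: ('i%C : R[i], x)].
pose phi x : R[i] := (lim (complex.Re (fev (g : rkhs k) (c1 x)) @[g --> F]) +i*
  lim (complex.Re (fev (g : rkhs k) (ci x)) @[g --> F]))%C.
exists phi; elim=> [|[c x] l IH].
  under eq_cvg do rewrite /fev big_nil.
  by rewrite /fev big_nil; apply: cvg_cst.
have split_ev (psi : X -> R[i]) : complex.Re (fev psi ((c, x) :: l)) =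
    complex.Re c * complex.Re (fev psi (c1 x)) +
    complex.Im c * complex.Re (fev psi (ci x)) + complex.Re (fev psi l).
  rewrite /fev big_cons !big_seq1 ReD /=; congr (_ + _).
  by case: c (psi x) => a b [u v] /=; ring.
under eq_cvg do rewrite split_ev.
rewrite split_ev.
apply: cvgD => //; apply: cvgD; apply: cvgMr.
  have -> : complex.Re (fev phi (c1 x)) =
      lim (complex.Re (fev (g : rkhs k) (c1 x)) @[g --> F]).
    by rewrite /fev big_seq1 /=; ring.
  exact: cv.
have -> : complex.Re (fev phi (ci x)) =
    lim (complex.Re (fev (g : rkhs k) (ci x)) @[g --> F]).
  by rewrite /fev big_seq1 /=; ring.
exact: cv.
Qed.

(** Each [dualval] involves a single test sum and passes to the limit with a bound independent of
    it. The supremum, taken afterwards, yields both the membership of [phi] and convergence in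
    norm. *)
Lemma rk_complete (F : set_system (rkhs k)) : ProperFilter F -> cauchy F -> cvg F.
Proof.
move=> FF cF; have [phi phiP] := fev_cvg FF cF.
have dist (e : R) (g : rkhs k) : 0 < e -> F (ball g e%:C%C) ->
    forall l, dualval k ((g : X -> R[i]) - phi) l <= e ^+ 2.
  move=> e0 Fg l.
  have h : dualval k ((g : X -> R[i]) - (h : rkhs k)) l @[h --> F] -->
      dualval k ((g : X -> R[i]) - phi) l.
    rewrite /dualval fevB ReB.
    under eq_cvg do rewrite fevB ReB.
    by apply: cvgB; [apply: cvgMr; apply: cvgB; [exact: cvg_cst|exact: phiP]|exact: cvg_cst].
  apply: (cvgr_to_le h); apply: filterS Fg => u.
  rewrite -!ball_normE /ball_ /= normE ltcR rk_rnormE => gu.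
  rewrite -rk_valB; apply: le_trans (ksq_ub _ (rk_bounded _)) _.
  rewrite -/(rkQ _) -[leLHS]sqr_sqrtr ?rkQ_ge0//.
  by rewrite ler_pXn2r ?nnegrE ?sqrtr_ge0 ?(ltW e0)// ltW.
have near_g (e : R) : 0 < e -> exists g : rkhs k, F (ball g e%:C%C).
  by move=> e0; have /cauchyP := cF; apply; rewrite ltcR.
have phib : phi \in kbounded k.
  have [g Fg] := near_g 1 ltr01.
  have -> : phi = (g : X -> R[i]) - ((g : X -> R[i]) - phi) by rewrite subKr.
  apply: kboundedB; first exact: rk_bounded.
  by apply/kboundedP; exists (1 ^+ 2); apply: dist.
pose f := Rkhs phib; apply/cvg_ex; exists f; apply/cvgrPdist_lt => e e0.
have {e0} [r r0 ->] : exists2 r : R, 0 < r & e = r%:C%C.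
  have ee : e = (complex.Re e)%:C%C by rewrite RRe_real ?gtr0_real.
  by exists (complex.Re e) => //; rewrite -ltcR -ee.
have r2 : 0 < r / 2 by rewrite divr_gt0.
have [g Fg] := near_g _ r2.
have sub : ball g (r / 2)%:C%C `<=` [set h : rkhs k | `|f - h| < r%:C%C].
  move=> h; rewrite -ball_normE /ball_ /= (normE (g - h)) ltcR => gh.
  rewrite normE ltcR.
  have -> : f - h = (f - g) + (g - h) by rewrite addrA subrK.
  rewrite (splitr r); apply: le_lt_trans (rnormD _ _) _; rewrite ler_ltD//.
  rewrite -rnormN opprB rk_rnormE -[leRHS]ger0_norm ?(ltW r2)// -sqrtr_sqr ler_wsqrtr//.
  by apply: ksq_le => l; apply: dist.
exact: filterS sub Fg.
Qed.

HB.instance Definition _ := Uniform_isComplete.Build (rkhs k) rk_complete.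

Lemma rk_ip_norm f : rk_ip f f = `|f| ^+ 2.
Proof. by rewrite rk_ipxx normE rk_rnormE -rmorphXn /= sqr_sqrtr ?rkQ_ge0. Qed.

HB.instance Definition _ := NormedModule_isHilbert.Build R (rkhs k) rk_ip_norm.

Definition rk_point x : rkhs k := rk_lin [:: (1, x)].

Lemma rk_pointE x y : rk_point x y = k x y.
Proof. by rewrite /rk_point /= /flin big_seq1 mul1r. Qed.

Lemma rk_reproducing f x : ip f (rk_point x) = f x.
Proof.
have fli : 'i%C *: rk_point x = rk_lin [:: ('i%C, x)].
  by apply: rk_ext => y; rewrite -[LHS]/('i%C * rk_point x y) rk_pointE /= /flin big_seq1.
rewrite ipE fli /rip !rk_ip_lin /fev !big_seq1.
by apply/eqP; rewrite eq_complex; case: (f x) => a b /=; apply/andP; split; apply/eqP; ring.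
Qed.

End RkhsNorm.

(** * The word kernel and its dilations *)

Section WordKernel.
Context {R : realType} {H : hilbertType R} {n : nat}.
Implicit Types (rho : R) (T : 'I_n -> {linear H -> H}) (a b : seq 'I_n) (x y : H).

Lemma word_opD T a x y : word_op T a (x + y) = word_op T a x + word_op T a y.
Proof. by elim: a => //= i a ->; rewrite linearD. Qed.

Lemma word_opZ T a (c : R[i]) x : word_op T a (c *: x) = c *: word_op T a x.
Proof. by elim: a => //= i a ->; rewrite linearZ. Qed.

Lemma word_op0 T a : word_op T a 0 = 0.
Proof. by have := word_opZ T a 0 0; rewrite !scale0r. Qed.

Lemma word_op_sum T a (I : Type) (s : seq I) (F : I -> H) :
  word_op T a (\sum_(i <- s) F i) = \sum_(i <- s) word_op T a (F i).
Proof. exact: (big_morph _ (word_opD T a) (word_op0 T a)). Qed.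

Lemma word_op_cat T a b x : word_op T (a ++ b) x = word_op T a (word_op T b x).
Proof. by rewrite /word_op foldr_cat. Qed.

(* [kern rho T a b x y] is the value that [<V_a x, V_b y>] takes for every
   dilation [V] of [T]. *)
Fixpoint kern rho T a b x y : R[i] :=
  match a, b with
  | [::], [::] => ip x y
  | i :: a', j :: b' => if i == j then kern rho T a' b' x y else 0
  | _, [::] => (rho^-1)%:C%C * ip (word_op T a x) y
  | [::], _ => (rho^-1)%:C%C * ip x (word_op T b y)
  end.

Lemma kernC rho T a b x y : kern rho T b a y x = Num.conj (kern rho T a b x y).
Proof.
have conjR (r : R) : Num.conj r%:C%C = r%:C%C by apply: conjc_real.
elim: a b => [|i a IH] [|j b] /=.
- exact: ipC.
- by rewrite rmorphM /= -ipC; congr (_ * _); rewrite conjR.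
- by rewrite rmorphM /= -ipC; congr (_ * _); rewrite conjR.
by rewrite eq_sym; case: ifP => // _; rewrite rmorph0.
Qed.

Lemma kernDl rho T a b x x' y :
  kern rho T a b (x + x') y = kern rho T a b x y + kern rho T a b x' y.
Proof.
elim: a b => [|i a IH] [|j b] /=.
- exact: linearDl.
- by rewrite ipDl mulrDr.
- by rewrite -/(word_op T _ _) word_opD linearD ipDl mulrDr.
by case: ifP => // _; rewrite addr0.
Qed.

Lemma kernZl rho T a b (c : R[i]) x y :
  kern rho T a b (c *: x) y = c * kern rho T a b x y.
Proof.
elim: a b => [|i a IH] [|j b] /=.
- exact: linearZl_LR.
- by rewrite ipZl mulrCA.
- by rewrite -/(word_op T _ _) word_opZ linearZ ipZl mulrCA.
by case: ifP => // _; rewrite mulr0.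
Qed.

Lemma kernZr rho T a b (c : R[i]) x y :
  kern rho T a b x (c *: y) = Num.conj c * kern rho T a b x y.
Proof. by rewrite kernC kernZl rmorphM /= -kernC. Qed.

Lemma kern0l rho T a b y : kern rho T a b 0 y = 0.
Proof. by have := kernZl rho T a b 0 0 y; rewrite scale0r mul0r. Qed.

Lemma kernDr rho T a b x y y' :
  kern rho T a b x (y + y') = kern rho T a b x y + kern rho T a b x y'.
Proof. by rewrite kernC kernDl rmorphD /= -!kernC. Qed.

(** Scalar coefficients are absorbed into the vectors, as [kern] is sesquilinear in them. *)
Definition kform rho T (l : seq (seq 'I_n * H)) : R :=
  \sum_(p <- l) \sum_(q <- l) complex.Re (kern rho T p.1 q.1 p.2 q.2).

Definition kpsd rho T := forall l, 0 <= kform rho T l.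

Lemma class_C_kpsd rho T : 0 < rho -> class_C rho T -> kpsd rho T.
Proof.
move=> rho0 [K [J [P [V [Jiso Pproj Viso Vorth TV]]]]] l.
have Jiso' x y : ip (J x) (J y) = ip x y by exact: Jiso.
have Viso' i (x y : K) : ip (V i x) (V i y) = ip x y by exact: Viso.
have PJ u h : ip (P u) h = ip u (J h).
  by have := Pproj u h; rewrite ipBl Jiso' => /eqP; rewrite subr_eq0 => /eqP.
have JP h u : ip h (P u) = ip (J h) u.
  by rewrite ipC PJ -ipC.
have rK z : (rho^-1)%:C%C * (rho%:C%C * z) = z.
  by rewrite mulrA -rmorphM mulVf ?gt_eqF// mul1r.
have kernE a b x y :
    kern rho T a b x y = ip (word_op V a (J x)) (word_op V b (J y)).
  elim: a b => [|i a IH] [|j b].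
  - by rewrite /= Jiso'.
  - rewrite [LHS]/= -[T j _]/(word_op T (j :: b) y) TV// ipZr.
    by rewrite (_ : Num.conj rho%:C%C = rho%:C%C) ?rK ?JP//; apply: conjc_real.
  - by rewrite [LHS]/= -[T i _]/(word_op T (i :: a) x) TV// ipZl rK PJ.
  - rewrite /=; case: (altP (i =P j)) => [<-|ij]; first by rewrite Viso' IH.
    by rewrite Vorth.
suff -> : kform rho T l = complex.Re (ip (\sum_(p <- l) word_op V p.1 (J p.2))
    (\sum_(p <- l) word_op V p.1 (J p.2))) by apply: ripxx_ge0.
rewrite -/(rip _ _) rip_suml; apply: eq_bigr => p _.
by rewrite rip_sumr; apply: eq_bigr => q _; rewrite kernE.
Qed.

Section Dilation.
Variables (rho : R) (T : 'I_n -> {linear H -> H}).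
Hypotheses (rho_gt0 : 0 < rho) (Tpsd : kpsd rho T).
Local Notation X := (seq 'I_n * H)%type.

Let kf (p q : X) := kern rho T p.1 q.1 p.2 q.2.

Let kfC p q : kf q p = Num.conj (kf p q).
Proof. exact: kernC. Qed.

Let kf_psd (l : seq (R[i] * X)) :
  0 <= complex.Re (\sum_(p <- l) \sum_(q <- l) p.1 * Num.conj q.1 * kf p.2 q.2).
Proof.
have := Tpsd [seq (p.2.1, p.1 *: p.2.2) | p <- l].
rewrite /kform big_map Re_sum; congr (_ <= _); apply: eq_bigr => p _.
rewrite big_map Re_sum; apply: eq_bigr => q _.
by rewrite kernZl kernZr mulrA.
Qed.

Let k := PsdKernel kfC kf_psd.
Let K : hilbertType R := rkhs k.

Let shiftX i (p : X) : X := (i :: p.1, p.2).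

Let fev_shift (phi : X -> R[i]) i l :
  fev (phi \o shiftX i) l = fev phi [seq (p.1, shiftX i p.2) | p <- l].
Proof. by rewrite /fev big_map. Qed.

(** Prefixing one letter to both words leaves [kern] unchanged; dually, the restriction [A_ i] does
    not increase the norm. *)
Let qf_shift i l : qf k [seq (p.1, shiftX i p.2) | p <- l] = qf k l.
Proof.
rewrite /qf !gramE big_map; congr complex.Re; apply: eq_bigr => p _.
by rewrite big_map; apply: eq_bigr => q _; rewrite /= /kf /= eqxx.
Qed.

Let dualval_shift (f : K) i l :
  dualval k (f \o shiftX i) l = dualval k f [seq (p.1, shiftX i p.2) | p <- l].
Proof. by rewrite /dualval qf_shift fev_shift. Qed.

Let bounded_shift (f : K) i : (f : X -> R[i]) \o shiftX i \in kbounded k.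
Proof.
apply/kboundedP; exists (ksq k f) => l; rewrite dualval_shift.
exact/ksq_ub/rk_bounded.
Qed.

Let A_ i (f : K) : K := Rkhs (bounded_shift f i).

Let A_linear i : linear (A_ i).
Proof. by move=> c f g; apply: rk_ext. Qed.

Let A i : {linear K -> K} :=
  HB.pack (A_ i) (GRing.isLinear.Build _ _ _ _ (A_ i) (A_linear i)).

Let A_bounded i (f : K) : rnorm (A i f) <= 1 * rnorm f.
Proof.
rewrite mul1r !rk_rnormE ler_wsqrtr//; apply: ksq_le => l.
by rewrite dualval_shift; apply/ksq_ub/rk_bounded.
Qed.

Let V_spec i : {L : {linear K -> K} | forall f g, ip (A i f) g = ip f (L g)}.
Proof.
have [B hB] := cid (adjoint_exists (@A_bounded i)).
by have [L hL] := adjoint_linear hB; exists L => f g; rewrite hL.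
Qed.

Let V i := projT1 (V_spec i).

Let VP i f g : ip (A i f) g = ip f (V i g).
Proof. exact: (projT2 (V_spec i)). Qed.

Let VP' i f g : ip g (A i f) = ip (V i g) f.
Proof. by rewrite ipC VP -ipC. Qed.

Let pt (p : X) : K := rk_point p.

Let V_pt i p : V i (pt p) = pt (shiftX i p).
Proof.
apply: rk_ext => q; rewrite -(rk_reproducing (V i (pt p))) -VP' -/(pt _).
by rewrite ipC rk_reproducing -[A i _ p]/(rk_point q (shiftX i p)) !rk_pointE -kfunC.
Qed.

(** This contains both requirements on the [V i]: isometry for [i = j], orthogonal ranges otherwise.
    It reduces to [A j] on kernel functions, where [kern] cancels equal first letters and vanishes
    on distinct ones. *)
Let AV i j f : A i (V j f) = if i == j then f else 0.
Proof.
apply: rk_ext => p; rewrite -[LHS]/(V j f (shiftX i p)).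
rewrite -(rk_reproducing (V j f)) -VP'.
have -> : A j (rk_point (shiftX i p)) = if i == j then pt p else 0.
  apply: rk_ext => q; rewrite -[LHS]/(pt (shiftX i p) (shiftX j q)) rk_pointE /= /kf /=.
  by case: eqP => // _; rewrite rk_pointE.
by case: eqP => _; rewrite ?rk_reproducing// ipC ip0l rmorph0.
Qed.

Let J_ (x : H) : K := pt ([::], x).

Let J_linear : linear J_.
Proof.
move=> c x y; apply: rk_ext => q.
rewrite -[RHS]/(c * J_ x q + J_ y q) !rk_pointE.
by rewrite /= /kf kernDl kernZl.
Qed.

Let J : {linear H -> K} := HB.pack J_ (GRing.isLinear.Build _ _ _ _ J_ J_linear).

Let Jiso : isometry ip ip J.
Proof. by move=> x y; rewrite -[LHS]/(ip (J_ x) (rk_point ([::], y))) rk_reproducing rk_pointE. Qed.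

Lemma kpsd_class_C : class_C rho T.
Proof.
have Jiso' x y : ip (J x) (J y) = ip x y by exact: Jiso.
have Jb x : rnorm (J x) <= 1 * rnorm x.
  by rewrite mul1r !rnormE /rip Jiso.
have [P hP] := cid (adjoint_exists Jb).
have hP' f h : ip (P f) h = ip f (J h).
  by rewrite ipC -hP -ipC.
have word_pt a x : word_op V a (J x) = pt (a, x).
  by elim: a => //= i a ->; rewrite V_pt.
exists K, J, P, V; split=> //.
- by move=> f h; rewrite ipBl Jiso' hP' subrr.
- by move=> i f g; rewrite -[LHS]/(ip (V i f) (V i g)) -VP AV eqxx.
- by move=> i j ij f g; rewrite -VP AV eq_sym (negbTE ij) ip0l.
(* [P f] tested against [h] is the value of [f] at the empty word and [h]; there [kern] carries the
   factor [rho^-1], which [rho] cancels. *)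
move=> [//|i a] x _; rewrite word_pt.
have rK z : z = rho%:C%C * ((rho^-1)%:C%C * z).
  by rewrite mulrA -rmorphM mulfV ?gt_eqF// mul1r.
apply: rip_inj => h; rewrite /rip !(ipC h); congr (complex.Re (Num.conj _)).
by rewrite ipZl hP' -[J h]/(rk_point ([::], h)) rk_reproducing rk_pointE /= /kf /= -rK.
Qed.

End Dilation.

Lemma class_CP rho T : 0 < rho -> class_C rho T <-> kpsd rho T.
Proof. by move=> rho0; split; [exact: class_C_kpsd | exact: kpsd_class_C]. Qed.

End WordKernel.

(** * Operations preserving positivity of the word kernel *)

Section KpsdClosure.
Context {R : realType} {H : hilbertType R} {n : nat}.
Implicit Types (rho s : R) (z : R[i]) (T : 'I_n -> {linear H -> H}).
Implicit Types (a b : seq 'I_n) (x y : H).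

Lemma word_op_ext T T' a x : (forall i x, T i x = T' i x) ->
  word_op T a x = word_op T' a x.
Proof. by move=> TT'; elim: a => //= i a ->; rewrite TT'. Qed.

Lemma kern_ext rho T T' a b x y : (forall i x, T i x = T' i x) ->
  kern rho T a b x y = kern rho T' a b x y.
Proof.
move=> TT'; elim: a b => [|i a IH] [|j b] //=; last by rewrite IH.
  by rewrite TT' -!/(word_op _ _ _) (word_op_ext _ _ TT').
by rewrite TT' -!/(word_op _ _ _) (word_op_ext _ _ TT').
Qed.

Lemma kpsd_ext rho T T' : (forall i x, T i x = T' i x) -> kpsd rho T -> kpsd rho T'.
Proof.
move=> TT' Tp l; rewrite (_ : kform _ _ _ = kform rho T l)//.
by apply: eq_bigr => p _; apply: eq_bigr => q _; rewrite (kern_ext rho _ _ _ _ TT').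
Qed.

Lemma word_op_scale z T a x :
  word_op (scale_tuple z T) a x = z ^+ size a *: word_op T a x.
Proof.
elim: a => [|i a IH] /=; first by rewrite scale1r.
by rewrite IH linearZ scalerA exprS.
Qed.

(** One of the truncated differences is [0], so the exponent is the distance of the lengths: where
    [kern] does not vanish, one word is a prefix of the other and only the remaining letters act. *)
Lemma kern_scale rho s T a b x y :
  kern rho (scale_tuple s%:C%C T) a b x y =
  (s ^+ ((size a - size b) + (size b - size a)))%:C%C * kern rho T a b x y.
Proof.
elim: a b => [|i a IH] [|j b].
- by rewrite mul1r.
- rewrite [LHS]/= -[X in ip _ X]/(word_op (scale_tuple s%:C%C T) (j :: b) y).
  rewrite word_op_scale ipZr mulrCA [RHS]/=; congr (_ * _).
  by rewrite -rmorphXn; apply: conjc_real.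
- rewrite [LHS]/= -[X in ip X _]/(word_op (scale_tuple s%:C%C T) (i :: a) x).
  by rewrite word_op_scale ipZl mulrCA [RHS]/= addn0 -rmorphXn.
- by rewrite /= !subSS IH; case: ifP => // _; rewrite mulr0.
Qed.

(** For unimodular [z], [z ^+ size a] times the conjugate of [z ^+ size b] depends only on the
    difference of the lengths. *)
Lemma kern_phase rho z T a b x y : z * Num.conj z = 1 ->
  kern rho (scale_tuple z T) a b x y =
  kern rho T a b (z ^+ size a *: x) (z ^+ size b *: y).
Proof.
move=> zz; rewrite kernZl kernZr.
elim: a b => [|i a IH] [|j b].
- by rewrite /= rmorph1 !mul1r.
- rewrite [LHS]/= -[X in ip _ X]/(word_op (scale_tuple z T) (j :: b) y).
  by rewrite word_op_scale ipZr mulrCA /= mul1r.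
- rewrite [LHS]/= -[X in ip X _]/(word_op (scale_tuple z T) (i :: a) x).
  by rewrite word_op_scale ipZl mulrCA /= rmorph1 mul1r.
- rewrite /= IH; case: ifP => _; rewrite ?mulr0// !exprS rmorphM /=.
  have e (u v w p k : R[i]) : u * v * (w * p * k) = u * w * (v * (p * k)) by ring.
  by rewrite e zz mul1r.
Qed.

Lemma kpsd_phase rho z T : z * Num.conj z = 1 -> kpsd rho T ->
  kpsd rho (scale_tuple z T).
Proof.
move=> zz Tp l; have := Tp [seq (p.1, z ^+ size p.1 *: p.2) | p <- l].
rewrite /kform big_map; congr (_ <= _); apply: eq_bigr => p _.
by rewrite big_map; apply: eq_bigr => q _; rewrite kern_phase.
Qed.

(* Gram decomposition of the Toeplitz kernel [s ^ |i - j|]. *)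
Lemma toeplitz_gram s i j M : (i <= M)%N ->
  s ^+ i * s ^+ j + (1 - s ^+ 2) * (\sum_(m < M)
     (if (m < i)%N && (m < j)%N then s ^+ (i - m.+1) * s ^+ (j - m.+1) else 0)) =
  s ^+ ((i - j) + (j - i)).
Proof.
elim: i j M => [|i IH] j M iM.
  by rewrite big1 ?mulr0 ?addr0 ?mul1r ?sub0n ?subn0.
case: j => [|j].
  by rewrite big1 ?mulr0 ?addr0 ?mulr1 ?sub0n ?subn0 ?addn0// => m _; rewrite andbF.
case: M iM => // M iM; rewrite big_ord_recl /= !subn1 /= !subSS -(IH j M)//.
under eq_bigr do rewrite /bump /= add1n !ltnS !subSS.
by rewrite !exprS; ring.
Qed.

(** A factor [c (size a) * c (size b)] merely rescales the vectors of the list. By [toeplitz_gram]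
    the Toeplitz kernel is a combination of such factors with coefficients [1] and [1 - s ^+ 2],
    both nonnegative. *)
Lemma kpsd_scale rho s T : 0 <= s <= 1 -> kpsd rho T ->
  kpsd rho (scale_tuple s%:C%C T).
Proof.
move=> /andP[s0 s1] Tp l.
pose M := \max_(p <- l) size p.1.
have sizeM p : p \in l -> (size p.1 <= M)%N by move=> pl; apply: leq_bigmax_seq.
pose w (m : nat) (i : nat) : R := if (m < i)%N then s ^+ (i - m.+1) else 0.
pose lw (c : nat -> R) := [seq (p.1, (c (size p.1))%:C%C *: p.2) | p <- l].
have kform_lw c : kform rho T (lw c) = \sum_(p <- l) \sum_(q <- l)
    c (size p.1) * c (size q.1) * complex.Re (kern rho T p.1 q.1 p.2 q.2).
  rewrite /kform big_map; apply: eq_bigr => p _.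
  rewrite big_map; apply: eq_bigr => q _.
  rewrite kernZl kernZr (_ : Num.conj _ = (c (size q.1))%:C%C).
    by rewrite !ReZ mulrA.
  exact: conjc_real.
suff -> : kform rho (scale_tuple s%:C%C T) l =
    kform rho T (lw (fun i => s ^+ i)) +
    (1 - s ^+ 2) * \sum_(m < M) kform rho T (lw (w m)).
  apply: addr_ge0; first exact: Tp.
  apply: mulr_ge0; first by rewrite subr_ge0 exprn_ile1.
  by apply: sumr_ge0 => m _; apply: Tp.
under [in RHS]eq_bigr do rewrite kform_lw.
rewrite kform_lw [X in _ + _ * X]exchange_big mulr_sumr -big_split /=.
apply: eq_big_seq => p pl; rewrite [X in _ + _ * X]exchange_big mulr_sumr -big_split /=.
apply: eq_big_seq => q ql.
rewrite kern_scale ReZ -(@toeplitz_gram s _ _ M (sizeM p pl)) mulrDl; congr (_ + _).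
rewrite -mulrA; congr (_ * _); rewrite mulr_suml; apply: eq_bigr => m _.
by rewrite /w; case: ltnP => _; case: ltnP => _ /=; rewrite ?mul0r ?mulr0 ?mul0r.
Qed.

(** For a fixed list the form is a polynomial in [s], hence continuous at [1]. *)
Lemma kpsd_lim rho T :
  (forall s, 0 < s < 1 -> kpsd rho (scale_tuple s%:C%C T)) -> kpsd rho T.
Proof.
move=> sTp l.
pose P : {poly R} := \sum_(p <- l) \sum_(q <- l)
  complex.Re (kern rho T p.1 q.1 p.2 q.2) *:
    'X^((size p.1 - size q.1) + (size q.1 - size p.1)).
have PE s : P.[s] = kform rho (scale_tuple s%:C%C T) l.
  rewrite horner_sum; apply: eq_bigr => p _.
  rewrite horner_sum; apply: eq_bigr => q _.
  by rewrite kern_scale ReZ hornerZ hornerXn mulrC.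
have P1 : P.[1] = kform rho T l.
  rewrite PE; apply: eq_bigr => p _; apply: eq_bigr => q _.
  by rewrite kern_scale expr1n mul1r.
have cP : P.[s] @[s --> (1 : R)^'-] --> P.[1].
  by apply: cvg_at_left_filter; apply: continuous_horner.
rewrite -P1; apply: (cvgr_to_ge cP).
near=> s; rewrite PE; apply: sTp; apply/andP; split; near: s.
  exact: nbhs_left_gt.
exact: nbhs_left_lt.
Unshelve. all: by end_near. Qed.

Lemma kpsd_le rho rho' T : 0 < rho -> rho <= rho' -> kpsd rho T -> kpsd rho' T.
Proof.
move=> rho0 rr Tp l.
(* Since [0 ^+ 0 = 1], scaling by [0] keeps the entries with words of equal length, the part of the
   kernel free of [rho]. The weight [t] below is chosen so that [t / rho = 1 / rho']. *)
have Zp := @kpsd_scale rho 0 T ltac:(by rewrite lexx ler01) Tp l.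
have rho'0 : 0 < rho' := lt_le_trans rho0 rr.
pose t := rho / rho'.
have t0 : 0 <= t by rewrite divr_ge0 ?ltW.
have t1 : t <= 1 by rewrite ler_pdivrMr// mul1r.
suff -> : kform rho' T l =
    t * kform rho T l + (1 - t) * kform rho (scale_tuple 0%:C%C T) l.
  by rewrite addr_ge0// mulr_ge0// subr_ge0.
rewrite !mulr_sumr -big_split; apply: eq_bigr => p _ /=.
rewrite !mulr_sumr -big_split; apply: eq_bigr => q _ /=.
rewrite kern_scale ReZ.
have inv_t : t * rho^-1 = rho'^-1.
  by rewrite /t; field; rewrite !gt_eqF.
elim: (p.1) (q.1) => [|i a IH] [|j b].
- by rewrite /= expr0; ring.
- by rewrite !ReZ subn0 exprS mul0r mul0r mulr0 addr0 mulrA inv_t.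
- by rewrite !ReZ subn0 exprS mul0r mul0r mulr0 addr0 mulrA inv_t.
- rewrite /= !subSS; case: ifP => _; first exact: IH.
  by rewrite !mulr0 addr0.
Qed.

End KpsdClosure.

(** * Operator norms and row operators *)

Section OpNorm.
Context {R : realType} {H : hilbertType R}.
Implicit Types (A S : H -> H) (x y : H) (C M r : R).

Lemma opnorm_ub S M x :
  (forall r x, S (r%:C%C *: x) = r%:C%C *: S x) ->
  (forall x, rnorm (S x) <= M * rnorm x) ->
  rnorm (S x) <= opnorm S * rnorm x.
Proof.
move=> SZ SM.
have bnd : has_ubound [set rnorm (S x) | x in [set x : H | rnorm x <= 1]].
  exists `|M| => _ [u u1 <-]; apply: le_trans (SM u) _.
  apply: le_trans (ler_norm _) _; rewrite normrM ler_piMr//.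
  by rewrite ger0_norm ?rnorm_ge0.
have [x0|/eqP x0] := eqVneq (rnorm x) 0.
  by have := SM x; rewrite x0 !mulr0.
have xp : 0 < rnorm x by rewrite lt_def rnorm_ge0 andbT; apply/eqP.
rewrite -ler_pdivrMr//; apply: ub_le_sup => //.
exists ((rnorm x)^-1%:C%C *: x).
  by rewrite /= rnormZ rnormC gtr0_norm ?invr_gt0// mulVf//; apply/eqP.
by rewrite SZ rnormZ rnormC gtr0_norm ?invr_gt0// mulrC.
Qed.

Lemma opnorm_le S C : 0 <= C -> (forall x, rnorm (S x) <= C * rnorm x) ->
  opnorm S <= C.
Proof.
move=> C0 SC; apply: ge_sup; first by exists (rnorm (S 0)), 0 => //=; rewrite rnorm0.
move=> _ [u /= u1 <-]; apply: le_trans (SC u) _.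
by rewrite ler_piMr.
Qed.

Lemma opnorm_ge0 S M : (forall x, rnorm (S x) <= M * rnorm x) -> 0 <= opnorm S.
Proof.
move=> SM; apply: le_trans (rnorm_ge0 (S 0)) _; apply: ub_le_sup; last first.
  by exists 0 => //=; rewrite rnorm0.
exists `|M| => _ [u u1 <-]; apply: le_trans (SM u) _.
apply: le_trans (ler_norm _) _; rewrite normrM ler_piMr//.
by rewrite ger0_norm ?rnorm_ge0.
Qed.

Lemma adjointP A (L : {linear H -> H}) C : (forall x, A x = L x) ->
  (forall x, rnorm (A x) <= C * rnorm x) ->
  forall x y, ip (A x) y = ip x (adjoint A y).
Proof.
move=> AL AC.
have LC x : rnorm (L x) <= C * rnorm x by rewrite -AL.
have [B hB] := adjoint_exists LC.
apply: (@getPex _ [set B : H -> H | forall x y, ip (A x) y = ip x (B y)]).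
by exists B => x y /=; rewrite AL hB.
Qed.

End OpNorm.

Section RowOperator.
Context {R : realType} {H : hilbertType R} {I : finType}.
Variables (A : I -> H -> H) (L : I -> {linear H -> H}) (C : I -> R).
Hypotheses (AL : forall i x, A i x = L i x)
           (AC : forall i x, rnorm (A i x) <= C i * rnorm x).

Let S x := \sum_i A i (adjoint (A i) x).

Let adjP i x y : rip (A i x) y = rip x (adjoint (A i) y).
Proof. by rewrite /rip (adjointP (AL i) (AC i)). Qed.

Let adjZ i (r : R) x : adjoint (A i) (r%:C%C *: x) = r%:C%C *: adjoint (A i) x.
Proof. by apply: rip_inj => y; rewrite -adjP !ripZr adjP. Qed.

Let adj_sum x : \sum_i rnorm (adjoint (A i) x) ^+ 2 = rip (S x) x.
Proof. by rewrite rip_suml; apply: eq_bigr => i _; rewrite adjP ripxx. Qed.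

Let adjC i x : rnorm (adjoint (A i) x) <= C i * rnorm x.
Proof.
have [x0|/eqP x0] := eqVneq (rnorm (adjoint (A i) x)) 0.
  by rewrite x0; apply: le_trans (AC i x); rewrite rnorm_ge0.
have xp : 0 < rnorm (adjoint (A i) x) by rewrite lt_def rnorm_ge0 andbT; apply/eqP.
rewrite -(ler_pM2l xp) -expr2 -ripxx -adjP.
apply: le_trans (ler_norm _) _; apply: le_trans (rip_le _ _) _.
rewrite mulrA; apply: ler_wpM2r; first exact: rnorm_ge0.
by rewrite mulrC; apply: AC.
Qed.

Let SM x : rnorm (S x) <= (\sum_i `|C i| ^+ 2) * rnorm x.
Proof.
rewrite mulr_suml /S; elim/big_ind2: _ => [|u s v t hu hv|i _].
- by rewrite rnorm0.
- by apply: le_trans (rnormD _ _) _; apply: lerD.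
apply: le_trans (AC _ _) _; apply: (@le_trans _ _ (`|C i| * rnorm (adjoint (A i) x))).
  by rewrite ler_wpM2r ?rnorm_ge0 ?ler_norm.
rewrite expr2 -mulrA ler_wpM2l//; apply: le_trans (adjC _ _) _.
by rewrite ler_wpM2r ?rnorm_ge0 ?ler_norm.
Qed.

Let SZ (r : R) x : S (r%:C%C *: x) = r%:C%C *: S x.
Proof. by rewrite /S scaler_sumr; apply: eq_bigr => i _; rewrite adjZ !AL linearZ. Qed.

Lemma row_opnorm_ge0 : 0 <= opnorm S.
Proof. exact: opnorm_ge0 SM. Qed.

(** One half of the C*-identity for the row of the [A i], whose product with its adjoint is [S],
    proved without a direct sum of copies of [H]. *)
Lemma row_opnorm_bound (y : I -> H) :
  rnorm (\sum_i A i (y i)) ^+ 2 <= opnorm S * \sum_i rnorm (y i) ^+ 2.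
Proof.
set Z := \sum_i _; set Y := \sum_i _; set N := opnorm S.
have Y0 : 0 <= Y by apply: sumr_ge0 => i _; apply: sqr_ge0.
have N0 : 0 <= N := row_opnorm_ge0.
have bZ : \sum_i rnorm (adjoint (A i) Z) ^+ 2 <= N * rnorm Z ^+ 2.
  rewrite adj_sum; apply: le_trans (ler_norm _) _; apply: le_trans (rip_le _ _) _.
  rewrite expr2 mulrA ler_wpM2r ?rnorm_ge0//; exact: opnorm_ub SZ SM.
(* Expanding the squares gives [s^2 Y - 2 s |Z|^2] plus a term at most [s |Z|^2], and [s] divides
   out. As [N] may be [0], a positive [s] is used and [N] is only approached at the end. *)
have key (s : R) : 0 < s -> N <= s -> rnorm Z ^+ 2 <= s * Y.
  move=> s0 Ns.
  have : 0 <= \sum_i rip (s%:C%C *: y i - adjoint (A i) Z) (s%:C%C *: y i - adjoint (A i) Z).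
    by apply: sumr_ge0 => i _; apply: ripxx_ge0.
  have -> : \sum_i rip (s%:C%C *: y i - adjoint (A i) Z) (s%:C%C *: y i - adjoint (A i) Z) =
      s ^+ 2 * Y - 2 * s * rnorm Z ^+ 2 + \sum_i rnorm (adjoint (A i) Z) ^+ 2.
    rewrite -[in X in _ - X]ripxx {1}/Z rip_suml /Y !mulr_sumr -sumrB -big_split.
    apply: eq_bigr => i _ /=.
    by rewrite ripBB !(ripZl, ripZr) !ripxx adjP; ring.
  have : N * rnorm Z ^+ 2 <= s * rnorm Z ^+ 2 by rewrite ler_wpM2r ?sqr_ge0.
  move=> h1 h2.
  have : 0 <= s * (s * Y - rnorm Z ^+ 2) by lra.
  by rewrite pmulr_rge0// subr_ge0.
apply/ler_addgt0Pr => e e0.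
have Y1 : 0 < Y + 1 by lra.
have e1 : 0 < e / (Y + 1) by rewrite divr_gt0.
apply: le_trans (key (N + e / (Y + 1)) _ _) _; [lra|lra|].
rewrite mulrDl lerD2l mulrAC ler_pdivrMr//.
by rewrite ler_pM2l//; lra.
Qed.

(** Taking for [y i] the adjoint of [A i] at [x] turns the row into [S x] and the right side into
    [c * rip (S x) x]; one factor [rnorm (S x)] cancels. *)
Lemma row_opnorm_least (c : R) : 0 <= c ->
  (forall y : I -> H, rnorm (\sum_i A i (y i)) ^+ 2 <= c * \sum_i rnorm (y i) ^+ 2) ->
  opnorm S <= c.
Proof.
move=> c0 hc; apply: opnorm_le => // x.
have [x0|/eqP x0] := eqVneq (rnorm (S x)) 0.
  by rewrite x0 mulr_ge0 ?rnorm_ge0.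
have xp : 0 < rnorm (S x) by rewrite lt_def rnorm_ge0 andbT; apply/eqP.
rewrite -(ler_pM2l xp) -expr2; apply: le_trans (hc _) _.
rewrite adj_sum mulrCA ler_wpM2l//.
by apply: le_trans (ler_norm _) _; apply: rip_le.
Qed.

End RowOperator.

(** * Positivity from norms of rows *)

Section Estimate.
Context {R : realType} {H : hilbertType R} {n : nat}.
Variables (T : 'I_n -> {linear H -> H}) (c : nat -> R).
Hypothesis c_ge0 : forall k, 0 <= c k.
Hypothesis row_bound : forall k (y : seq 'I_n -> H),
  rnorm (\sum_(g : k.-tuple 'I_n) word_op T g (y g)) ^+ 2 <=
  c k ^+ 2 * \sum_(g : k.-tuple 'I_n) rnorm (y g) ^+ 2.
Implicit Types (rho : R) (a b : seq 'I_n) (x y : H).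

(** The entries where [b] is a proper prefix of [a], without their factor [rho^-1]: [k.+1] makes the
    remainder [g] nonempty, and [N] will bound the lengths that occur. *)
Let E N a b x y : R := \sum_(k < N) \sum_(g : k.+1.-tuple 'I_n)
  (if a == b ++ g then rip (word_op T g x) y else 0).

Let E_cons N i j a b x y :
  E N (i :: a) (j :: b) x y = if i == j then E N a b x y else 0.
Proof.
case: eqP => [->|ij].
  by apply: eq_bigr => k _; apply: eq_bigr => g _; rewrite /= eqseq_cons eqxx.
rewrite /E big1// => k _; rewrite big1// => g _.
by rewrite /= eqseq_cons (introF eqP ij).
Qed.

Let E_nil N b x y : E N [::] b x y = 0.
Proof.
rewrite /E big1// => k _; rewrite big1// => g _; case: eqP => // e.
by have := congr1 size e; rewrite size_cat (size_tuple g) addnS.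
Qed.

Let E_word N i a x y : (size a < N)%N ->
  E N (i :: a) [::] x y = rip (word_op T (i :: a) x) y.
Proof.
move=> aN; rewrite /E (bigD1 (Ordinal aN))//= (bigD1 (in_tuple (i :: a)))//= eqxx.
rewrite !big1 ?addr0// => [k ka|g ga].
  rewrite big1// => g _; case: eqP => // e; case/negP: ka; apply/eqP/val_inj.
  by have := congr1 size e; rewrite (size_tuple g) /= => -[].
by case: eqP => // e; case/negP: ga; apply/eqP/val_inj.
Qed.

Let kernE rho N a b x y : (size a <= N)%N -> (size b <= N)%N ->
  complex.Re (kern rho T a b x y) = (if a == b then rip x y else 0) +
    rho^-1 * (E N a b x y + E N b a y x).
Proof.
elim: a b => [|i a IH] [|j b] aN bN.
- by rewrite !E_nil addr0 mulr0 addr0.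
- by rewrite [LHS]/= ReZ -/(rip _ _) -/(word_op T (j :: b) y) E_nil E_word// !add0r ripC.
- by rewrite [LHS]/= ReZ -/(rip _ _) -/(word_op T (i :: a) x) E_nil E_word// add0r addr0.
- rewrite /= !E_cons eqseq_cons (eq_sym j); case: ifP => _ /=; last by rewrite addr0 mulr0 addr0.
  by apply: IH; apply: ltnW.
Qed.

(** A list may attach several vectors to one word, while the row bounds concern one vector per
    word. *)
Let collect (l : seq (seq 'I_n * H)) a := \sum_(p <- l | p.1 == a) p.2.

Let sum_collect (l : seq (seq 'I_n * H)) (F : seq 'I_n -> H -> R) :
  (forall a x y, F a (x + y) = F a x + F a y) ->
  \sum_(p <- l) F p.1 p.2 = \sum_(a <- undup [seq p.1 | p <- l]) F a (collect l a).
Proof.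
move=> FD; have F0 a : F a 0 = 0.
  by have /eqP := FD a 0 0; rewrite addr0 -subr_eq0 opprD addNKr oppr_eq0 => /eqP.
under [RHS]eq_bigr do rewrite /collect (big_morph (F _) (FD _) (F0 _)).
rewrite (exchange_big_dep predT)//= big_seq [RHS]big_seq; apply: eq_bigr => p pl.
rewrite -big_filter (_ : [seq _ <- _ | _] = [:: p.1]) ?big_seq1//.
rewrite (eq_filter (a2 := pred1 p.1)); last by move=> a /=; rewrite eq_sym.
by rewrite filter_pred1_uniq ?undup_uniq// mem_undup map_f.
Qed.

(** A word has at most one factorisation [b ++ g] with [g] of length [k], so each [F a] is counted
    at most once. *)
Let sum_shift (A : seq (seq 'I_n)) k (F : seq 'I_n -> R) : uniq A ->
  (forall a, 0 <= F a) -> (forall a, a \notin A -> F a = 0) ->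
  \sum_(b <- A) \sum_(g : k.-tuple 'I_n) F (b ++ g) <= \sum_(a <- A) F a.
Proof.
move=> uA F0 FA.
have FE a : F a = \sum_(a' <- A | a' == a) F a'.
  rewrite -big_filter; have [aA|aA] := boolP (a \in A).
    by rewrite filter_pred1_uniq// big_seq1.
  rewrite FA// big_filter big_seq_cond big1// => a' /andP[a'A /eqP e].
  by rewrite -e a'A in aA.
under eq_bigr do under eq_bigr do rewrite FE big_mkcond.
under eq_bigr do rewrite exchange_big.
rewrite exchange_big; apply: ler_sum => a _ /=.
pose u := take (size a - k) a; pose v := drop (size a - k) a.
apply: (@le_trans _ _ (\sum_(b <- A) \sum_(g : k.-tuple 'I_n)
   (if b == u then 1 else 0) * ((if val g == v then 1 else 0) * F a))).
  apply: ler_sum => b _; apply: ler_sum => g _.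
  case: eqP => [e|_]; last first.
    by apply: mulr_ge0; [case: ifP | apply: mulr_ge0; [case: ifP | exact: F0]].
  have eu : b = u by rewrite /u e size_cat size_tuple addnK take_size_cat.
  have ev : val g = v by rewrite /v e size_cat size_tuple addnK drop_size_cat.
  by rewrite -eu -ev !eqxx !mul1r.
under eq_bigr do rewrite -mulr_sumr -mulr_suml.
rewrite -mulr_suml mulrA ler_piMl//.
rewrite mulr_ile1//; try by apply: sumr_ge0 => *; case: ifP.
  rewrite -big_mkcond /= big_const_seq iter_addr_0 (count_uniq_mem u uA).
  by case: (u \in A).
have [w|w] := boolP (size v == k); last first.
  rewrite big1// => g _; case: eqP => // gv.
  by move: w; rewrite -gv size_tuple eqxx.
rewrite (bigD1 (Tuple w))//= eqxx big1 ?addr0//.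
move=> g gv; case: eqP => // gv'; case/negP: gv.
by apply/eqP/val_inj.
Qed.

Lemma kpsd_of_row_bounds rho : 0 < rho ->
  (forall N, 2 * (\sum_(k < N) c k.+1) <= rho) -> kpsd rho T.
Proof.
move=> rho0 hc l.
pose A := undup [seq p.1 | p <- l]; pose h := collect l.
have uA : uniq A := undup_uniq _.
have hA a : a \notin A -> h a = 0.
  move=> aA; rewrite /h /collect big_seq_cond big1// => p /andP[pl /eqP pa].
  by rewrite -pa mem_undup map_f in aA.
have -> : kform rho T l =
    \sum_(a <- A) \sum_(b <- A) complex.Re (kern rho T a b (h a) (h b)).
  rewrite /kform (@sum_collect l (fun a x => \sum_(q <- l) complex.Re (kern rho T a q.1 x q.2))).
    apply: eq_bigr => a _; apply: (@sum_collect l (fun b y => complex.Re (kern rho T a b (h a) y))).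
    by move=> b x y; rewrite kernDr ReD.
  by move=> a x y; rewrite -big_split; apply: eq_bigr => q _; rewrite kernDl ReD.
pose N := \max_(a <- A) size a.
have sizeN a : a \in A -> (size a <= N)%N by move=> aA; apply: leq_bigmax_seq.
pose D := \sum_(a <- A) rnorm (h a) ^+ 2.
have D0 : 0 <= D by apply: sumr_ge0 => a _; apply: sqr_ge0.
pose W k := \sum_(b <- A) rip (\sum_(g : k.-tuple 'I_n) word_op T g (h (b ++ g))) (h b).
(* For the two norms [z], [w] at [b] and [z ^+ 2 <= c k ^+ 2 * Y], expanding [(z - c k * w) ^+ 2]
   gives [z * w <= c k / 2 * (Y + w ^+ 2)]. Summed over [b], each of [Y] and [w ^+ 2] contributes at
   most [D]. *)
have WD k : - (c k * D) <= W k.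
  rewrite lerNl; apply: (@le_trans _ _ (\sum_(b <- A) (c k / 2 *
      \sum_(g : k.-tuple 'I_n) rnorm (h (b ++ g)) ^+ 2 + c k / 2 * rnorm (h b) ^+ 2))).
    rewrite /W -sumrN; apply: ler_sum => b _; rewrite -ripNl.
    apply: le_trans (ler_norm _) _; apply: le_trans (rip_le _ _) _; rewrite rnormN.
    have := row_bound k (fun g => h (b ++ g)).
    set z := rnorm _; set Y := \sum_(g : _) _; set w := rnorm _ => zY.
    have z0 : 0 <= z := rnorm_ge0 _; have w0 : 0 <= w := rnorm_ge0 _.
    have [ck|/eqP ck] := eqVneq (c k) 0.
      move: zY; rewrite ck expr0n mul0r => z2.
      have -> : z = 0 by apply/eqP; rewrite -sqrf_eq0; apply/eqP/le_anti; rewrite z2 sqr_ge0.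
      by rewrite !mul0r addr0.
    have cp : 0 < c k by rewrite lt_def c_ge0 andbT; apply/eqP.
    rewrite -(ler_pM2l cp).
    by have := sqr_ge0 (z - c k * w); lra.
  have sD : \sum_(b <- A) \sum_(g : k.-tuple 'I_n) rnorm (h (b ++ g)) ^+ 2 <= D.
    apply: (@sum_shift A k (fun a => rnorm (h a) ^+ 2)) => // [a|a /hA ->].
      exact: sqr_ge0.
    by rewrite rnorm0 expr0n.
  rewrite big_split -!mulr_sumr /= -/D.
  have : c k / 2 * (\sum_(b <- A) \sum_(g : k.-tuple 'I_n) rnorm (h (b ++ g)) ^+ 2) <= c k / 2 * D.
    by rewrite ler_wpM2l// divr_ge0.
  by lra.
have sumE : \sum_(a <- A) \sum_(b <- A) E N a b (h a) (h b) = \sum_(k < N) W k.+1.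
  rewrite exchange_big /=; under eq_bigr do rewrite exchange_big.
  rewrite exchange_big; apply: eq_bigr => k _ /=; apply: eq_bigr => b _.
  rewrite exchange_big rip_suml; apply: eq_bigr => g _ /=.
  rewrite -big_mkcond /= -big_filter.
  have [bA|bA] := boolP (b ++ g \in A).
    by rewrite filter_pred1_uniq// big_seq1.
  rewrite (hA _ bA) word_op0 rip0l big_filter big_seq_cond big1// => a /andP[aA /eqP e].
  by rewrite -e aA in bA.
rewrite big_seq; under eq_bigr => a aA.
  rewrite big_seq; under eq_bigr => b bA do rewrite (kernE rho _ _ (sizeN a aA) (sizeN b bA)).
  rewrite -big_seq; over.
rewrite -big_seq.
under eq_bigr do rewrite big_split -mulr_sumr big_split.
rewrite big_split -mulr_sumr big_split /= sumE.
rewrite [X in _ * (_ + X)]exchange_big /= sumE.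
rewrite (_ : \sum_(a <- A) _ = D); last first.
  apply: eq_big_seq => a aA; rewrite -big_mkcond -big_filter /=.
  rewrite (eq_filter (a2 := pred1 a)) ?filter_pred1_uniq// ?big_seq1 ?ripxx//.
(* The two triangular halves of the kernel have the same sum, which is where the factor [2] of the
   hypothesis is spent. *)
have hW : - (rho / 2 * D) <= \sum_(k < N) W k.+1.
  apply: (@le_trans _ _ (\sum_(k < N) - (c k.+1 * D))).
    rewrite sumrN lerN2 -mulr_suml ler_wpM2r//.
    by rewrite ler_pdivlMr// mulrC.
  by apply: ler_sum => k _; apply: WD.
have -> : D + rho^-1 * (\sum_(k < N) W k.+1 + \sum_(k < N) W k.+1) =
   rho^-1 * 2 * (rho / 2 * D + \sum_(k < N) W k.+1).
  by field; rewrite gt_eqF.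
rewrite mulr_ge0 ?mulr_ge0 ?invr_ge0 ?(ltW rho0)//.
by lra.
Qed.

End Estimate.

(** * Fekete's lemma for submultiplicative sequences *)

Section Fekete.
Context {R : realType}.
Implicit Types (x q M : R) (b : nat -> R).

Lemma powR_root x k : 0 <= x -> (0 < k)%N -> (x `^ k%:R^-1) ^+ k = x.
Proof.
move=> x0 k0; rewrite -powR_mulrn ?powR_ge0// -powRrM mulVf ?powRr1//.
by rewrite pnatr_eq0 -lt0n.
Qed.

Lemma powR_root_le x q k : 0 <= x -> 0 <= q -> (0 < k)%N ->
  (x `^ k%:R^-1 <= q) = (x <= q ^+ k).
Proof.
by move=> x0 q0 k0; rewrite -[in RHS](powR_root x0 k0) ler_pXn2r ?nnegrE ?powR_ge0.
Qed.

(** By Bernoulli's inequality, [(q' / q) ^+ k] is at least [1 + k (q' / q - 1)]. *)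
Lemma exp_dominates M q q' : 0 < q -> q < q' ->
  exists N, forall k, (N <= k)%N -> M * q ^+ k <= q' ^+ k.
Proof.
move=> q0 qq; have r1 : 0 < q' / q - 1 by rewrite subr_gt0 ltr_pdivlMr// mul1r.
exists (Num.trunc (M / (q' / q - 1))).+1 => k Nk.
have q'E : q' = (1 + (q' / q - 1)) * q by field; rewrite gt_eqF.
rewrite [in leRHS]q'E exprMn ler_pM2r ?exprn_gt0//.
have bern : 1 + k%:R * (q' / q - 1) <= (1 + (q' / q - 1)) ^+ k.
  elim: k {Nk} => [|k IH]; first by rewrite mul0r addr0 expr0.
  rewrite exprS -natr1; move: r1 IH; set d := q' / q - 1; set e := (1 + d) ^+ k.
  move=> d0 IH; have k0 : 0 <= k%:R :> R by rewrite ler0n.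
  have : (1 + d) * (1 + k%:R * d) <= (1 + d) * e by rewrite ler_wpM2l//; lra.
  have : 0 <= k%:R * d * d by rewrite !mulr_ge0 // ltW.
  by lra.
have : M / (q' / q - 1) <= k%:R.
  by apply/ltW; apply: lt_le_trans (truncnS_gt _) _; rewrite ler_nat.
by rewrite ler_pdivrMr// => ?; apply: le_trans bern; lra.
Qed.

Variable b : nat -> R.
Hypotheses (b_ge0 : forall k, 0 <= b k)
           (b_submul : forall k m, b (k + m) <= b k * b m).

Lemma submul_exp k m j : b (j * m + k) <= b m ^+ j * b k.
Proof.
elim: j => [|j IH]; first by rewrite mul0n add0n expr0 mul1r.
rewrite mulSn -addnA; apply: le_trans (b_submul _ _) _.
by rewrite exprS -mulrA ler_wpM2l.
Qed.

Let rate : R := inf [set b k.+1 `^ k.+1%:R^-1 | k in [set: nat]].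

Let rate_le k : (0 < k)%N -> rate <= b k `^ k%:R^-1.
Proof.
case: k => // k _; apply: ge_inf; last by exists k.
by exists 0 => _ [m _ <-]; apply: powR_ge0.
Qed.

Let rate_ge0 : 0 <= rate.
Proof.
apply: lb_le_inf; first by exists (b 1 `^ 1%:R^-1), 0.
by move=> _ [m _ <-]; apply: powR_ge0.
Qed.


(** Some [m] has [b m.+1 <= q ^+ m.+1]. Dividing [k] by [m.+1] leaves a remainder [r]; [M] sums
    [b r / q ^+ r] over all remainders and so dominates the one that occurs. *)
Let rate_bound q : rate < q -> exists2 M, 0 <= M & forall k, b k <= M * q ^+ k.
Proof.
move=> rq; have q0 : 0 < q := le_lt_trans rate_ge0 rq.
have hinf : has_inf [set b k.+1 `^ k.+1%:R^-1 | k in [set: nat]].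
  split; first by exists (b 1 `^ 1%:R^-1), 0.
  by exists 0 => _ [m _ <-]; apply: powR_ge0.
have qr : 0 < q - rate by rewrite subr_gt0.
have [_ [m _ <-]] := inf_adherent qr hinf.
rewrite -/rate subrKC => /ltW; rewrite powR_root_le ?(ltW q0)// => bm.
exists (\sum_(r < m.+1) b r / q ^+ r).
  by apply: sumr_ge0 => r _; rewrite divr_ge0 ?exprn_ge0 ?(ltW q0).
move=> k; rewrite (divn_eq k m.+1); set j := (k %/ _)%N; set r := (k %% _)%N.
have rm : (r < m.+1)%N by rewrite ltn_mod.
apply: le_trans (submul_exp _ _ _) _.
apply: (@le_trans _ _ ((q ^+ m.+1) ^+ j * b r)).
  by rewrite ler_wpM2r ?lerXn2r ?nnegrE ?exprn_ge0 ?(ltW q0).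
rewrite -exprM mulnC exprD mulrCA ler_wpM2l ?exprn_ge0 ?(ltW q0)//.
rewrite -ler_pdivrMr ?exprn_gt0//.
rewrite (bigD1 (Ordinal rm))//= lerDl sumr_ge0// => i _.
by rewrite divr_ge0 ?exprn_ge0 ?(ltW q0).
Qed.

(** The bound for every [k] is kept besides the limit, as [kpsd_of_growth] consumes a geometric
    majorant. *)
Lemma fekete : exists L : R, [/\ 0 <= L,
  b k `^ k%:R^-1 @[k --> \oo] --> L &
  forall q, L < q -> exists2 M, 0 <= M & forall k, b k <= M * q ^+ k].
Proof.
exists rate; split=> //.
apply/cvgrPdist_le => e e0.
have e2 : 0 < e / 2 by rewrite divr_gt0.
have [|M M0 hM] := @rate_bound (rate + e / 2); first by rewrite ltrDl.
have [||N hN] := @exp_dominates M (rate + e / 2) (rate + e).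
- by rewrite ltr_wpDl.
- by rewrite ltrD2l ltr_pdivrMr// mulr_natr mulr2n ltrDl.
exists N.+1 => // k /= Nk.
have k0 : (0 < k)%N by apply: leq_trans Nk.
rewrite distrC ger0_norm ?subr_ge0 ?rate_le// lerBlDl powR_root_le//.
  by apply: le_trans (hM k) _; apply: hN; apply: ltnW.
by rewrite addr_ge0// ltW.
Qed.

End Fekete.

(** * Bounds on words coming from a dilation *)

Section DilationBounds.
Context {R : realType} {H : hilbertType R} {n : nat}.
Implicit Types (rho t : R) (T : 'I_n -> {linear H -> H}).

(** Distinct words of equal length give isometries with orthogonal ranges, so [U] has squared norm
    [\sum_i rnorm (y i) ^+ 2], and the row is [rho] times its projection. The index type [I] allows
    one letter, all letters or all words of a length. *)
Lemma class_C_row_bound rho T (I : finType) (w : I -> seq 'I_n) k (y : I -> H) :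
  0 <= rho -> class_C rho T -> injective w -> (forall i, size (w i) = k.+1) ->
  rnorm (\sum_i word_op T (w i) (y i)) ^+ 2 <= rho ^+ 2 * \sum_i rnorm (y i) ^+ 2.
Proof.
move=> rho0 [K [J [P [V [Jiso Pproj Viso Vorth TV]]]]] winj wk.
have Jiso' x x' : ip (J x) (J x') = ip x x' by exact: Jiso.
have Viso' i (x x' : K) : ip (V i x) (V i x') = ip x x' by exact: Viso.
have PJ u h : ip (P u) h = ip u (J h).
  by have := Pproj u h; rewrite ipBl Jiso' => /eqP; rewrite subr_eq0 => /eqP.
have Vword a b (x x' : K) : size a = size b ->
    ip (word_op V a x) (word_op V b x') = if a == b then ip x x' else 0.
  elim: a b => [|i a IH] [|j b] //= [ab]; rewrite eqseq_cons.
  by case: (altP (i =P j)) => [<-|ij]; [rewrite Viso' IH | rewrite Vorth].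
set Z := \sum_i _; pose U := \sum_i word_op V (w i) (J (y i)).
have UU : rnorm U ^+ 2 = \sum_i rnorm (y i) ^+ 2.
  rewrite -ripxx rip_suml; apply: eq_bigr => i _.
  rewrite rip_sumr (bigD1 i)//= big1 ?addr0 => [|j ji].
    by rewrite /rip Vword// eqxx Jiso' -/(rip _ _) ripxx.
  by rewrite /rip Vword ?wk// inj_eq// eq_sym (negbTE ji).
have ZU : rnorm Z ^+ 2 = rho * rip U (J Z).
  rewrite -ripxx {1}/Z rip_suml /U rip_suml mulr_sumr; apply: eq_bigr => i _.
  rewrite TV ?ripZl; last by rewrite -size_eq0 wk.
  by rewrite /rip PJ.
have JZ : rnorm (J Z) = rnorm Z by rewrite !rnormE /rip Jiso'.
have h : rnorm Z ^+ 2 <= rho * (rnorm U * rnorm Z).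
  rewrite ZU ler_wpM2l//; apply: le_trans (ler_norm _) _.
  by rewrite -JZ rip_le.
rewrite -UU -exprMn ler_pXn2r ?nnegrE ?mulr_ge0 ?rnorm_ge0//.
have [z0|/eqP z0] := eqVneq (rnorm Z) 0; first by rewrite z0 mulr_ge0 ?rnorm_ge0.
have zp : 0 < rnorm Z by rewrite lt_def rnorm_ge0 andbT; apply/eqP.
by rewrite -(ler_pM2r zp) -expr2 -mulrA.
Qed.

Lemma scaled_class_C_row_bound rho t T (I : finType) (w : I -> seq 'I_n) k (y : I -> H) :
  0 <= rho -> 0 < t -> class_C rho (scale_tuple t^-1%:C%C T) ->
  injective w -> (forall i, size (w i) = k.+1) ->
  rnorm (\sum_i word_op T (w i) (y i)) ^+ 2 <=
  (rho * t ^+ k.+1) ^+ 2 * \sum_i rnorm (y i) ^+ 2.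
Proof.
move=> rho0 t0 TC winj wk.
have := class_C_row_bound y rho0 TC winj wk.
under eq_bigr do rewrite word_op_scale wk.
have tk : 0 < t ^+ k.+1 by rewrite exprn_gt0.
rewrite -scaler_sumr -rmorphXn rnormZ rnormC ger0_norm ?exprn_ge0 ?invr_ge0 ?(ltW t0)//.
rewrite exprVn !exprMn exprVn ler_pdivrMl ?exprn_gt0// => h.
by rewrite [_ * (t ^+ _) ^+ 2]mulrC -mulrA.
Qed.

End DilationBounds.

(** * Norms of the rows of words of a given length *)

Section WordNorms.
Context {R : realType} {H : hilbertType R} {n : nat}.
Variable (T : 'I_n -> {linear H -> H}).
Hypothesis T_bounded : forall i, bounded_near (T i) (nbhs (0 : H)).
Implicit Types (rho t : R).

Lemma bounded_rnorm (A : {linear H -> H}) : bounded_near A (nbhs (0 : H)) ->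
  exists C : R, forall x, rnorm (A x) <= C * rnorm x.
Proof.
move=> /linear_boundedP [M [Mreal hM]].
have [m mM] : exists m : R, M = m%:C%C.
  by exists (complex.Re M); rewrite RRe_real.
exists (m + 1) => x; have := hM (m + 1)%:C%C; rewrite mM ltcR ltrDl ltr01 => /(_ isT x).
by rewrite !normE -rmorphM lecR.
Qed.

Let word_linear a : {L : {linear H -> H} | forall x, word_op T a x = L x}.
Proof.
have wl : linear (word_op T a) by move=> c x y; rewrite word_opD word_opZ.
pose L : {linear H -> H} := HB.pack (word_op T a) (GRing.isLinear.Build _ _ _ _ _ wl).
by exists L.
Qed.

Let word_bounded a : exists C : R, forall x, rnorm (word_op T a x) <= C * rnorm x.
Proof.
elim: a => [|i a [C hC]]; first by exists 1 => x; rewrite mul1r.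
have [D hD] := bounded_rnorm (@T_bounded i).
exists (`|D| * C) => x /=; apply: le_trans (hD _) _.
apply: (@le_trans _ _ (`|D| * rnorm (word_op T a x))).
  by rewrite ler_wpM2r ?rnorm_ge0 ?ler_norm.
by rewrite -mulrA ler_wpM2l.
Qed.

Let L a := projT1 (word_linear a).
Let LE a x : word_op T a x = L a x. Proof. exact: (projT2 (word_linear a)). Qed.
Let C a := projT1 (cid (word_bounded a)).
Let CE a x : rnorm (word_op T a x) <= C a * rnorm x.
Proof. exact: (projT2 (cid (word_bounded a))). Qed.

Definition word_norm2 k := opnorm (fun x : H => \sum_(alpha : k.-tuple 'I_n)
  word_op T alpha (adjoint (word_op T alpha) x)).

Definition word_norm k := Num.sqrt (word_norm2 k).

Let A k := fun g : k.-tuple 'I_n => word_op T g.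

Let word_norm2_ge0 k : 0 <= word_norm2 k.
Proof.
exact: (@row_opnorm_ge0 _ _ _ (@A k) (fun g => L g) (fun g => C g)
  (fun g => LE g) (fun g => CE g)).
Qed.

Let word_norm2_bound k (y : k.-tuple 'I_n -> H) :
  rnorm (\sum_(g : k.-tuple 'I_n) word_op T g (y g)) ^+ 2 <=
  word_norm2 k * \sum_(g : k.-tuple 'I_n) rnorm (y g) ^+ 2.
Proof.
exact: (@row_opnorm_bound _ _ _ (@A k) (fun g => L g) (fun g => C g)
  (fun g => LE g) (fun g => CE g)).
Qed.

Lemma word_norm2_least k (c : R) : 0 <= c ->
  (forall y : k.-tuple 'I_n -> H,
     rnorm (\sum_(g : k.-tuple 'I_n) word_op T g (y g)) ^+ 2 <=
     c * \sum_(g : k.-tuple 'I_n) rnorm (y g) ^+ 2) ->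
  word_norm2 k <= c.
Proof.
move=> c0 hc.
exact: (@row_opnorm_least _ _ _ (@A k) (fun g => L g) (fun g => C g)
  (fun g => LE g) (fun g => CE g)).
Qed.

Lemma word_norm_ge0 k : 0 <= word_norm k.
Proof. exact: sqrtr_ge0. Qed.

Let word_norm_sqr k : word_norm k ^+ 2 = word_norm2 k.
Proof. by rewrite sqr_sqrtr. Qed.

Lemma spectral_seqE k : spectral_seq T k = word_norm k `^ k%:R^-1.
Proof.
rewrite /spectral_seq -/(word_norm2 k) -word_norm_sqr -powR_mulrn ?word_norm_ge0//.
by rewrite -powRrM invfM mulrA mulfV ?mul1r.
Qed.

Let sum_cat_tuple (V : nmodType) k m (F : seq 'I_n -> V) :
  \sum_(g : (k + m).-tuple 'I_n) F g =
  \sum_(u : k.-tuple 'I_n) \sum_(v : m.-tuple 'I_n) F (u ++ v).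
Proof.
rewrite pair_bigA /=.
have tk (g : (k + m).-tuple 'I_n) : size (take k g) == k.
  by rewrite size_takel// size_tuple leq_addr.
have dk (g : (k + m).-tuple 'I_n) : size (drop k g) == m.
  by rewrite size_drop size_tuple addKn.
rewrite (reindex (fun p : k.-tuple 'I_n * m.-tuple 'I_n => cat_tuple p.1 p.2))//.
exists (fun g => (Tuple (tk g), Tuple (dk g))) => [[u v] _ | g _].
  congr pair; apply: val_inj => /=.
    by rewrite take_size_cat ?size_tuple.
  by rewrite drop_size_cat ?size_tuple.
by apply: val_inj; rewrite /= cat_take_drop.
Qed.

(** The row of words of length [k + m] is the row of length [k] composed with copies of the row of
    length [m]. *)
Lemma word_norm_submul k m : word_norm (k + m) <= word_norm k * word_norm m.
Proof.
rewrite -sqrtrM// ler_wsqrtr//; apply: word_norm2_least; first exact: mulr_ge0.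
move=> y; pose y' (a : seq 'I_n) : H := if insub a is Some g then y g else 0.
have y'E (g : (k + m).-tuple 'I_n) : y g = y' g by rewrite /y' valK.
under eq_bigr do rewrite y'E.
under [in leRHS]eq_bigr do rewrite y'E.
rewrite (sum_cat_tuple _ _ (fun g => word_op T g (y' g))).
rewrite (sum_cat_tuple _ _ (fun g => rnorm (y' g) ^+ 2)).
under eq_bigr do under eq_bigr do rewrite word_op_cat.
under eq_bigr do rewrite -word_op_sum.
apply: le_trans (word_norm2_bound _) _; rewrite -mulrA ler_wpM2l//.
by rewrite mulr_sumr; apply: ler_sum => u _; apply: word_norm2_bound.
Qed.

(** With [x = q / t], the row norms of [T / t] are at most [M x ^+ k]; twice the sum of these bounds
    over [k >= 1] is [2 M x / (1 - x)], the constant in the hypothesis. *)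
Lemma kpsd_of_growth rho t q M : 0 < rho -> 0 <= M -> 0 <= q -> q < t ->
  (forall k, word_norm k <= M * q ^+ k) -> 2 * M * q / (t - q) <= rho ->
  kpsd rho (scale_tuple t^-1%:C%C T).
Proof.
move=> rho0 M0 q0 qt hM hrho.
have t0 : 0 < t := le_lt_trans q0 qt.
apply: (@kpsd_of_row_bounds _ _ _ _ (fun k => word_norm k / t ^+ k)) => //.
- by move=> k; rewrite divr_ge0 ?word_norm_ge0 ?exprn_ge0 ?(ltW t0).
- move=> k y; under eq_bigr do rewrite word_op_scale size_tuple.
  have tk : 0 < t ^+ k by rewrite exprn_gt0.
  rewrite -scaler_sumr -rmorphXn rnormZ rnormC ger0_norm ?exprn_ge0 ?invr_ge0 ?(ltW t0)//.
  rewrite exprVn !exprMn word_norm_sqr [word_norm2 k * _]mulrC -[leRHS]mulrA.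
  by rewrite ler_wpM2l ?sqr_ge0.
move=> N; apply: le_trans hrho; pose x := q / t.
have x0 : 0 <= x by rewrite divr_ge0 // ltW.
have x1 : x < 1 by rewrite ltr_pdivrMr// mul1r.
have geo : \sum_(k < N) x ^+ k <= (1 - x)^-1.
  rewrite -div1r ler_pdivlMr ?subr_gt0// mulrC.
  by have := subrX1 x N; have := exprn_ge0 N x0; lra.
have : \sum_(k < N) word_norm k.+1 / t ^+ k.+1 <= M * x * (1 - x)^-1.
  apply: (@le_trans _ _ (M * x * \sum_(k < N) x ^+ k)).
    rewrite mulr_sumr; apply: ler_sum => k _.
    rewrite -mulrA -exprS /x expr_div_n mulrA ler_wpM2r ?hM//.
    by rewrite invr_ge0 exprn_ge0 ?(ltW t0).
  by apply: ler_wpM2l geo; apply: mulr_ge0.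
have -> : 2 * M * q / (t - q) = 2 * (M * x * (1 - x)^-1).
  by rewrite /x; field; rewrite subr_eq0 !gt_eqF.
by rewrite ler_pM2l.
Qed.

(** This makes the set whose infimum is [omega] nonempty. *)
Lemma kpsd_exists rho : 0 < rho ->
  exists2 t : R, 0 < t & kpsd rho (scale_tuple t^-1%:C%C T).
Proof.
move=> rho0; pose q := word_norm 1; pose M := word_norm 0.
have q0 : 0 <= q := word_norm_ge0 _; have M0 : 0 <= M := word_norm_ge0 _.
have c0 : 0 <= 2 * M * q / rho by rewrite divr_ge0 ?mulr_ge0 // ltW.
(* Submultiplicativity gives the majorant [M q ^+ k], for which [kpsd_of_growth] asks that
   [t - q >= 2 M q / rho]; the [1] makes the gap positive. *)
pose t := q + 2 * M * q / rho + 1; exists t; first by rewrite /t; lra.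
apply: (@kpsd_of_growth rho t q M) => //; first by rewrite /t; lra.
  move=> k; have := submul_exp word_norm_ge0 word_norm_submul 0 1 k.
  by rewrite muln1 addn0 mulrC.
have tq : t - q = 2 * M * q / rho + 1 by rewrite /t; ring.
rewrite ler_pdivrMr tq; last by lra.
by rewrite mulrDr [rho * (_ / rho)]mulrC divfK ?gt_eqF//; lra.
Qed.

End WordNorms.

(** * Elementary properties of the operator radius *)

Section Omega.
Context {R : realType} {H : hilbertType R} {n : nat}.
Variable (rho : R).
Hypothesis rho_gt0 : 0 < rho.
Implicit Types (t : R) (z : R[i]) (T : 'I_n -> {linear H -> H}).

Lemma omega_le t T : 0 < t -> kpsd rho (scale_tuple t^-1%:C%C T) -> omega rho T <= t.
Proof.
move=> t0 Tp; apply: ge_inf; last by split=> //; apply/class_CP.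
by exists 0 => s [/ltW].
Qed.

Lemma omega_ge (c : R) T :
  (exists2 t, 0 < t & kpsd rho (scale_tuple t^-1%:C%C T)) ->
  (forall t, 0 < t -> class_C rho (scale_tuple t^-1%:C%C T) -> c <= t) ->
  c <= omega rho T.
Proof.
move=> [t t0 Tp] hc; apply: lb_le_inf.
  by exists t; split=> //; apply/class_CP.
by move=> s [s0 sC]; apply: hc.
Qed.

Lemma kpsd_scale_le s t T : 0 < s -> s <= t ->
  kpsd rho (scale_tuple s^-1%:C%C T) -> kpsd rho (scale_tuple t^-1%:C%C T).
Proof.
move=> s0 st Tp; have t0 := lt_le_trans s0 st.
have st1 : 0 <= s / t <= 1.
  by rewrite (divr_ge0 (ltW s0) (ltW t0)) ler_pdivrMr// mul1r.
apply: kpsd_ext (kpsd_scale st1 Tp) => i x.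
rewrite /scale_tuple /= scalerA -rmorphM; congr (_%:C%C *: _).
by field; rewrite !gt_eqF.
Qed.

Lemma kpsd_of_omega_lt t T :
  (exists2 t, 0 < t & kpsd rho (scale_tuple t^-1%:C%C T)) ->
  omega rho T < t -> kpsd rho (scale_tuple t^-1%:C%C T).
Proof.
move=> [u u0 up] ot.
have hinf : has_inf [set t : R | 0 < t /\ class_C rho (scale_tuple t^-1%:C%C T)].
  split; first by exists u; split=> //; apply/class_CP.
  by exists 0 => s [/ltW].
have to0 : 0 < t - omega rho T by rewrite subr_gt0.
have [s [s0 /class_CP sp]] := inf_adherent to0 hinf.
rewrite -/(omega rho T) subrKC => st.
by apply: kpsd_scale_le (sp rho_gt0); rewrite ?ltW.
Qed.

(** Scaling [T0] by [0] shows that the zero tuple has a positive kernel; every [t > 0] is then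
    admissible. *)
Lemma omega_zero T T0 : kpsd rho T0 -> (forall i x, T i x = 0) -> omega rho T = 0.
Proof.
move=> T0p TE.
have h t : kpsd rho (scale_tuple t^-1%:C%C T).
  apply: kpsd_ext (@kpsd_scale _ _ _ rho 0 _ _ T0p) => [i x|].
    by rewrite /scale_tuple /= TE scaler0 scale0r.
  by rewrite lexx ler01.
apply/le_anti/andP; split.
  by apply/ler_addgt0Pr => e e0; rewrite add0r omega_le.
by apply: omega_ge => [|t /ltW//]; exists 1.
Qed.

Lemma omega_ext T T' : (forall i x, T i x = T' i x) -> omega rho T = omega rho T'.
Proof.
move=> TT'; congr inf; apply/seteqP; split=> t [t0 /class_CP tp]; split=> //;
  apply/class_CP => //; apply: kpsd_ext (tp rho_gt0) => i x;
  by rewrite /scale_tuple /= TT'.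
Qed.

(** In [z = rnorm z * u] the unimodular [u] preserves positivity and the modulus is absorbed into
    [t]. *)
Lemma kpsd_scaleC z t T : z != 0 -> kpsd rho (scale_tuple t^-1%:C%C T) ->
  kpsd rho (scale_tuple (rnorm z * t)^-1%:C%C (scale_tuple z T)).
Proof.
move=> z0 tp; pose u := z / (rnorm z)%:C%C.
have nzC : (rnorm z)%:C%C != 0 :> R[i] by rewrite -normE normr_eq0.
have uu : u * Num.conj u = 1.
  rewrite -normCK normrM normfV !normE rnormC ger0_norm ?rnorm_ge0//.
  by rewrite mulfV ?expr1n.
apply: kpsd_ext (kpsd_phase uu tp) => i x.
rewrite /scale_tuple /= !scalerA; congr (_ *: _).
have nV : ((rnorm z)^-1)%:C%C = (rnorm z)%:C%C^-1 :> R[i] by apply: fmorphV.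
by rewrite /u invfM rmorphM /= nV [RHS]mulrC mulrA.
Qed.

Lemma rnorm_gt0 z : z != 0 -> 0 < rnorm z.
Proof.
by move=> z0; rewrite lt_def rnorm_ge0 andbT; apply: contra_neq z0 => /rnorm0_eq0.
Qed.

Lemma omega_scale_le z T : z != 0 ->
  (exists2 t, 0 < t & kpsd rho (scale_tuple t^-1%:C%C T)) ->
  omega rho (scale_tuple z T) <= rnorm z * omega rho T.
Proof.
move=> z0 hT.
have nz := rnorm_gt0 z0.
rewrite mulrC -ler_pdivrMr//; apply: omega_ge => // t t0 /class_CP tp.
rewrite ler_pdivrMr// [t * _]mulrC; apply: omega_le; first exact: mulr_gt0.
exact: kpsd_scaleC (tp rho_gt0).
Qed.

Lemma omega_scale z T :
  (exists2 t, 0 < t & kpsd rho (scale_tuple t^-1%:C%C T)) ->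
  omega rho (scale_tuple z T) = rnorm z * omega rho T.
Proof.
move=> hT; have [->|z0] := eqVneq z 0.
  have [t t0 tp] := hT; rewrite rnorm0 mul0r; apply: omega_zero tp _ => i x.
  by rewrite /scale_tuple /= scale0r.
apply/le_anti; rewrite omega_scale_le//=.
have nz := rnorm_gt0 z0.
(* The reverse inequality is [omega_scale_le] for [z^-1] and the scaled tuple. *)
have zV0 : z^-1 != 0 by rewrite invr_eq0.
have hzT : exists2 t, 0 < t & kpsd rho (scale_tuple t^-1%:C%C (scale_tuple z T)).
  have [t t0 tp] := hT; exists (rnorm z * t); first exact: mulr_gt0.
  exact: kpsd_scaleC.
have := omega_scale_le zV0 hzT.
rewrite (omega_ext (T' := T)) => [|i x]; last first.
  by rewrite /scale_tuple /= scalerA mulVf// scale1r.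
have -> : rnorm z^-1 = (rnorm z)^-1.
  by apply: complexI; rewrite -normE normfV normE fmorphV.
by rewrite ler_pdivlMl.
Qed.

End Omega.

(** * The operator radius against norms and the joint spectral radius *)

Section OmegaLimit.
Context {R : realType} {H : hilbertType R} {n : nat}.
Variable (T : 'I_n -> {linear H -> H}).
Hypothesis T_bounded : forall i, bounded_near (T i) (nbhs (0 : H)).

Lemma word_norm_le_dilation (rho t : R) k : 0 < rho -> 0 < t ->
  class_C rho (scale_tuple t^-1%:C%C T) -> word_norm T k.+1 <= rho * t ^+ k.+1.
Proof.
move=> rho0 t0 TC.
have c0 : 0 <= rho * t ^+ k.+1 by rewrite mulr_ge0 ?exprn_ge0 ?ltW.
rewrite -[leRHS]ger0_norm// -sqrtr_sqr ler_wsqrtr//.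
apply: word_norm2_least => //; first exact: sqr_ge0.
move=> y; apply: (scaled_class_C_row_bound (k := k) (w := fun g : k.+1.-tuple 'I_n => val g)) => //.
- exact: ltW.
- by move=> g; apply: size_tuple.
Qed.

Lemma row_norm_le (rho : R) : 0 < rho -> row_norm T <= rho * omega rho T.
Proof.
move=> rho0; rewrite mulrC -ler_pdivrMr//; apply: omega_ge => //.
  exact: kpsd_exists.
move=> t t0 TC; rewrite ler_pdivrMr// mulrC.
have c0 : 0 <= rho * t by rewrite mulr_ge0 ?ltW.
rewrite -[leRHS]ger0_norm// -sqrtr_sqr ler_wsqrtr//.
pose C i := projT1 (cid (bounded_rnorm (@T_bounded i))).
have hC i : forall x, rnorm (T i x) <= C i * rnorm x.
  exact: (projT2 (cid (bounded_rnorm (@T_bounded i)))).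
apply: (row_opnorm_least (A := fun i => T i : H -> H) (L := T) (C := C)) => //.
  exact: sqr_ge0.
move=> y; have := scaled_class_C_row_bound (k := 0) (w := fun i => [:: i]) y
  (ltW rho0) t0 TC.
by rewrite expr1; apply => // i j [].
Qed.

(** Every [t > 0] is admissible, and a dilation of [T / t] gives
    [rnorm (T i x) <= rho * t * rnorm x]. *)
Lemma omega_eq0 (rho : R) : 0 < rho -> omega rho T = 0 -> forall i x, T i x = 0.
Proof.
move=> rho0 w0 i x; apply: rnorm0_eq0; apply/le_anti; rewrite rnorm_ge0 andbT.
have h t : 0 < t -> class_C rho (scale_tuple t^-1%:C%C T) ->
    rnorm (T i x) <= rho * t * rnorm x.
  move=> t0 TC.
  have := scaled_class_C_row_bound (k := 0) (w := fun _ : 'I_1 => [:: i])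
    (fun=> x) (ltW rho0) t0 TC.
  rewrite !big_ord1 expr1 -exprMn => bound.
  rewrite -(@ler_pXn2r _ 2) ?nnegrE ?rnorm_ge0//.
    by apply: bound => // a b _; rewrite !ord1.
  by rewrite mulr_ge0 ?rnorm_ge0// mulr_ge0 ?ltW.
apply/ler_addgt0Pr => e e0; rewrite add0r.
have K0 : 0 < rho * (rnorm x + 1) by rewrite mulr_gt0//; have := rnorm_ge0 x; lra.
have t0 : 0 < e / (rho * (rnorm x + 1)) by rewrite divr_gt0.
have := kpsd_of_omega_lt rho0 (kpsd_exists T_bounded rho0) (t := e / (rho * (rnorm x + 1))).
rewrite w0 => /(_ t0)/(kpsd_class_C rho0)/(h _ t0) hx; apply: le_trans hx _.
have -> : rho * (e / (rho * (rnorm x + 1))) * rnorm x = e * (rnorm x / (rnorm x + 1)).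
  by field; move: (rnorm_ge0 x) => ?; rewrite !gt_eqF//; lra.
by rewrite ler_piMr ?(ltW e0)// ler_pdivrMr; have := rnorm_ge0 x; lra.
Qed.

(** If the radius is at most [1], then [s T] has a positive kernel for [0 < s < 1], as [1 / s]
    exceeds the infimum; [kpsd_lim] reaches [s = 1]. *)
Lemma class_CP_omega (rho : R) : 0 < rho -> class_C rho T <-> omega rho T <= 1.
Proof.
move=> rho0; have id1 : forall i x, scale_tuple 1^-1%:C%C T i x = T i x.
  by move=> i x; rewrite /scale_tuple /= invr1 scale1r.
split=> [/(class_CP _ rho0) Tp | w1].
  by apply: omega_le => //; apply: kpsd_ext Tp => i x; rewrite id1.
apply/(class_CP _ rho0); apply: kpsd_lim => s /andP[s0 s1].
rewrite -[s]invrK; apply: kpsd_of_omega_lt => //; first exact: kpsd_exists.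
by apply: le_lt_trans w1 _; rewrite invf_gt1.
Qed.

Lemma omega_spectral : exists L : R,
  [/\ spectral_seq T k @[k --> \oo] --> L,
      forall rho, 0 < rho -> L <= omega rho T &
      omega rho T @[rho --> +oo] --> L].
Proof.
have [L [L0 cL growth]] := fekete (@word_norm_ge0 _ _ _ T) (word_norm_submul T_bounded).
have Lomega rho : 0 < rho -> L <= omega rho T.
  move=> rho0; apply: omega_ge => //; first exact: kpsd_exists.
  move=> t t0 TC; rewrite leNgt; apply/negP => tL.
  (* For large [k] the factor [rho] of [word_norm_le_dilation] is absorbed by passing from [t] to
     the midpoint [q]; the roots then stay at most [q < L]. *)
  pose q := (t + L) / 2.
  have tq : t < q by rewrite /q; lra.
  have qL : q < L by rewrite /q; lra.
  have q0 : 0 < q := lt_trans t0 tq.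
  have [N hN] := exp_dominates rho t0 tq.
  have : L <= q.
    apply: (cvgr_to_le cL); exists N.+1 => // -[//|k] /= Nk.
    rewrite powR_root_le ?word_norm_ge0 ?(ltW q0)//.
    by apply: le_trans (word_norm_le_dilation k rho0 t0 TC) _; apply: hN; apply: ltnW.
  by rewrite leNgt qL.
exists L; split=> //; first by under eq_cvg do rewrite spectral_seqE//.
apply/cvgrPdist_le => e e0.
pose q := L + e / 2; pose t := L + e.
have q0 : 0 < q by rewrite /q; lra.
have qt : q < t by rewrite /q /t; lra.
have [M M0 hM] : exists2 M, 0 <= M & forall k, word_norm T k <= M * q ^+ k.
  by apply: growth; rewrite /q; lra.
(* The second entry is what [kpsd_of_growth] requires for [q < t]; the first keeps [rho]
   positive. *)
pose r0 := Num.max 1 (2 * M * q / (t - q)).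
near=> rho.
have rr : r0 < rho by near: rho; apply: nbhs_pinfty_gt; apply: num_real.
have rho0 : 0 < rho by apply: le_lt_trans rr; rewrite le_max ler01.
rewrite distrC ger0_norm ?subr_ge0 ?Lomega// lerBlDl -/t.
apply: omega_le => //; first exact: lt_trans q0 qt.
apply: (kpsd_of_growth T_bounded rho0 M0 (ltW q0) qt hM).
by apply/ltW; apply: le_lt_trans rr; rewrite le_max lexx orbT.
Unshelve. all: by end_near. Qed.

End OmegaLimit.

Theorem theorem4p2 (R : realType) (H : hilbertType R) (n : nat)
    (n_gt0 : (0 < n)%N) (rho : R) (rho_gt0 : 0 < rho)
    (T : 'I_n -> {linear H -> H})
    (T_bounded : forall i, bounded_near (T i) (nbhs (0 : H))) :
  [/\ (* (i) *)
      forall z : R[i], omega rho (scale_tuple z T) = rnorm z * omega rho T,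
      (* (ii) *)
      row_norm T <= rho * omega rho T,
      (* (iii) *)
      omega rho T = 0 <-> (forall (i : 'I_n) (x : H), T i x = 0),
      (* (iv) *)
      class_C rho T <-> omega rho T <= 1
    & (* (v) *)
      [/\ cvg (omega rho' T @[rho' --> +oo]),
          cvg (spectral_seq T k @[k --> \oo]),
          omega_infty T = joint_spectral_radius T
        & joint_spectral_radius T <= omega rho T] /\
      (* (vi) *)
      (forall rho' : R, rho <= rho' ->
         class_C rho `<=` (class_C rho' : set ('I_n -> {linear H -> H})) /\
         omega rho' T <= omega rho T)].
Proof.
have hT := kpsd_exists T_bounded rho_gt0.
split.
- by move=> z; apply: omega_scale.
- exact: row_norm_le.
- split; first exact: omega_eq0.
  by have [t _ tp] := hT; apply: omega_zero tp.
- exact: class_CP_omega.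
split.
  have [L [sL Lle oL]] := omega_spectral T_bounded.
  have -> : joint_spectral_radius T = L by apply: cvg_lim.
  have -> : omega_infty T = L by apply: cvg_lim.
  split=> //; last exact: Lle.
  - by apply/cvg_ex; exists L.
  - by apply/cvg_ex; exists L.
move=> rho' rr; have rho'_gt0 := lt_le_trans rho_gt0 rr.
have sub : class_C rho `<=` (class_C rho' : set ('I_n -> {linear H -> H})).
  by move=> T' /(class_CP _ rho_gt0) Tp; apply/(class_CP _ rho'_gt0)/(kpsd_le rho_gt0).
split=> //; apply: omega_ge => // t t0 TC.
by apply: omega_le => //; apply/(class_CP _ rho'_gt0)/sub.
Qed.
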